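(* In the log-Gaussian setting described in the context, let $J=\{j\le d:\ \beta_j=\max_{1\le i\le d}\beta_i\}$ and assume: for every $c>0$ and every $\epsilon>0$ there exists $u_0>0$ such that for all $u>u_0$, all $j\in J$ and all $i\le d$ with $i\neq j$, $$\sigma_{ij}(u)+c\sqrt{\frac{1-\sigma_{ij}(u)^2}{\log u}}\ \le\ \frac{\beta_j}{\beta_i}\,\frac{\log\big(\epsilon\, e_i^*(u)\big)}{\log u}.$$ Then the modified Asmussen–Kroese estimator $Z_{MAK}(u)$ is an unbiased estimator of $\alpha(u)=\mathbb P(S(u)>u)$ and has asymptotically vanishing relative error, i.e. $$\lim_{u\to\infty}\frac{\mathbb E\big[Z_{MAK}(u)^2\big]}{\alpha(u)^2}=1 .$$
   Context: Let $d\ge 2$ and let $\mathbf N=(N_1,\dots,N_d)^\top$ be a vector of independent standard Gaussian random variables. For each $u>0$ let $\Sigma_u=(\sigma_{ij}(u))$ be a positive definite correlation matrix ($\sigma_{ii}(u)=1$). Let $\lambda_1,\dots,\lambda_d>0$, $\beta_1,\dots,\beta_d>0$, and let $\gamma_u>0$ be constants with $\gamma_u\to\gamma\in(0,\infty)$ as $u\to\infty$. For each $j\le d$ and $u>0$ let $A_u^{(j)}$ be a non-singular $d\times d$ matrix with $A_u^{(j)}(A_u^{(j)})^\top=\Sigma_u$ whose $j$-th row is the $j$-th unit vector (e.g. a Cholesky factor after permuting coordinate $j$ to the first position); set $\mathbf Y(u)=A_u^{(j)}\mathbf N$ (so $Y_j(u)=N_j$; the law of $\mathbf Y(u)$ is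 $N(0,\Sigma_u)$ regardless of $j$), $X_i(u)=\lambda_i e^{\beta_i\gamma_u Y_i(u)}$, $S(u)=\sum_{i=1}^d X_i(u)$, $M(u)=\max_{i\le d}X_i(u)$, and $\alpha(u)=\mathbb P(S(u)>u)$. Define $$Z_j(u)=\mathbb P\big(S(u)>u,\ X_j(u)=M(u)\ \big|\ N_k,\ k\neq j\big),$$ computed with $\mathbf Y(u)=A_u^{(j)}\mathbf N$. Let $p_i(u)=\mathbb P(X_i(u)>u)$ and let $\mathcal I$ be a random index independent of $\mathbf N$ with $\mathbb P(\mathcal I=i)=p_i(u)/\sum_{k=1}^d p_k(u)$. The modified Asmussen–Kroese estimator is $$Z_{MAK}(u)=\Big(\sum_{k=1}^d p_k(u)\Big)\sum_{i=1}^d \mathbb I_{\{\mathcal I=i\}}\frac{Z_i(u)}{p_i(u)}.$$ Finally, for $u>\max_i\lambda_i$, $e_i^*(u)=\dfrac{(\beta_i\gamma_u)^2\,u}{\log(u/\lambda_i)}$ (this is $\beta_i\gamma_u u\, e(w)/w$ with $w=(u/\lambda_i)^{1/(\beta_i\gamma_u)}$ and $e(x)=x/\log x$). *)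

(* Defs.v *)
From mathcomp Require Import all_boot all_order all_algebra.
From mathcomp Require Import all_classical all_reals all_analysis.
Set Implicit Arguments. Unset Strict Implicit. Unset Printing Implicit Defensive.
Import Order.TTheory GRing.Theory Num.Theory.
Local Open Scope classical_set_scope.
Local Open Scope ring_scope.

Section LogGaussian.
Context {R : realType} {d : nat}.

Definition matvec (A : 'M[R]_d) (n : 'I_d -> R) : 'I_d -> R :=
  fun i => \sum_(k < d) A i k * n k.

Definition Xvec (lam beta : 'I_d -> R) (g : R) (y : 'I_d -> R) : 'I_d -> R :=
  fun i => lam i * expR (beta i * g * y i).

Definition Ssum (x : 'I_d -> R) : R := \sum_(i < d) x i.
Definition Mmax (x : 'I_d -> R) : R := \big[Num.max/0]_(i < d) x i.

Definition Xof (lam beta : 'I_d -> R) (gam : R -> R) (A : 'M[R]_d) (u : R)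
    (n : 'I_d -> R) : 'I_d -> R :=
  Xvec lam beta (gam u) (matvec A n).

Definition replace_at (n : 'I_d -> R) (j : 'I_d) (t : R) : 'I_d -> R :=
  fun k => if k == j then t else n k.

Definition estar (lam beta : 'I_d -> R) (gam : R -> R) (i : 'I_d) (u : R) : R :=
  (beta i * gam u) ^+ 2 * u / ln (u / lam i).

Section Prob.
Context {dT : measure_display} {T : measurableType dT} (P : probability T R).

Definition std_normal_rv (X : T -> R) : Prop :=
  measurable_fun setT X /\
  forall B : set R, measurable B -> P (X @^-1` B) = normal_prob 0 1 B.

(* mutual independence of N_1, ..., N_d and the random index I
   (product rule; taking B i = setT / C = setT gives every subfamily) *)
Definition mutually_indep (N : 'I_d -> T -> R) (I : T -> 'I_d) : Prop :=
  forall (B : 'I_d -> set R) (C : set 'I_d), (forall i, measurable (B i)) ->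
    P ((\bigcap_i (N i @^-1` B i)) `&` (I @^-1` C))
    = ((\prod_(i < d) fine (P (N i @^-1` B i))) * fine (P (I @^-1` C)))%:E.

Variables (lam beta : 'I_d -> R) (gam : R -> R) (A : 'I_d -> R -> 'M[R]_d)
          (N : 'I_d -> T -> R).

Definition Nvec (w : T) : 'I_d -> R := fun k => N k w.

Definition alpha (j0 : 'I_d) (u : R) : R :=
  fine (P [set w | u < Ssum (Xof lam beta gam (A j0 u) u (Nvec w))]).

(* p_i(u) = P(X_i(u) > u)   (computed with A^{(i)}, so that Y_i = N_i) *)
Definition p_tail (i : 'I_d) (u : R) : R :=
  fine (P [set w | u < Xof lam beta gam (A i u) u (Nvec w) i]).

(* Z_j(u) = P(S(u) > u, X_j(u) = M(u) | N_k, k <> j), with Y = A^{(j)} N: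
   the conditional probability given (N_k)_{k<>j}, computed by integrating
   out the independent standard Gaussian N_j. *)
Definition Zcond (j : 'I_d) (u : R) (w : T) : R :=
  fine (normal_prob 0 1
    [set t : R | let x := Xof lam beta gam (A j u) u (replace_at (Nvec w) j t) in
                 u < Ssum x /\ x j = Mmax x]).

Definition Zmak (I : R -> T -> 'I_d) (u : R) (w : T) : R :=
  (\sum_(k < d) p_tail k u) *
  \sum_(i < d) ((I u w == i)%:R * (Zcond i u w / p_tail i u)).

End Prob.
End LogGaussian.

(* Main.v *)
(** Write [L = ln u] and let [j] have maximal [beta j]. Conditionally on [N_k], [k <> j], the
    set of values of [N_j] for which [S > u] and [X_j = M] is pinned down as soon as
    [|N_k| <= C sqrt L] for all [k]: while [X_j <= 2 u], the correlation condition forces every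
    other [X_i] to be [o(u / L)], and moving the level [u] by [o(u / L)] changes the Gaussian
    tail [p_j] only by a factor [1 + o(1)]. Hence [Z_j = (1 + o(1)) p_j] on that event. On its
    complement [Z_j <= P(X_j > u / d) <= u^K p_j], and the complement has probability at most
    [u^(-C^2 / 2)] up to a constant, which is negligible for [C] large. Indices with smaller
    [beta] contribute [P(X_i > u / d)^2 / p_i = o(p_j)].
    Unbiasedness needs that the law of [A^(j) N] does not depend on [j]: the factors differ by
    an orthogonal matrix, which is a product of plane rotations and reflections, and a plane
    rotation is a product of three shears, each preserving Lebesgue measure. *)

Require Import Defs.
From HB Require Import structures.
From mathcomp Require Import all_boot all_order all_algebra.
From mathcomp Require Import all_classical all_reals all_analysis.
From mathcomp Require Import measurable_realfun ring lra.
Import Order.TTheory GRing.Theory Num.Theory.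
Import numFieldTopology.Exports numFieldNormedType.Exports.
Local Open Scope classical_set_scope.
Local Open Scope ring_scope.

(** * The Gaussian measure on the line and its rotation invariance on the plane *)

(** The scale u / ln u is critical: thresholds [y] are of order ln u, and changing ln u by delta /
    ln u moves [y] by some [h] of order delta / ln u, so that y h stays bounded by a multiple of
    delta while the tail changes by a factor of about exp(- y h). No expansion of the Gaussian tail
    is used: all comparisons come from [pdf (s + h) = expR (- (s * h) - h ^+ 2 / 2) * pdf s]. The
    order of choices explains the quantifiers of the correlation condition. The exponent K is fixed
    before C, and C before the constant c, which has to dominate the fluctuations of the other
    coordinates; epsilon is chosen after delta. The other coordinates are controlled only while X_j
    <= 2 u. The upper bound on Z_j respects this because it argues by contradiction from X_j <= u,
    the lower bound because it keeps only the values u < X_j <= 2 u, which carry almost all of p_j.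
    The denominator alpha gets no asymptotics of its own: it is the sum of the means of the Z_i, so
    the first moments bound it from below, and Jensen's inequality supplies the other half of the
    limit. *)

Section GaussianLine.
Context {R : realType}.
Local Notation mu := (@lebesgue_measure R).
Local Notation gauss := (@normal_prob R 0 1).
Local Notation pdf := (@normal_pdf R 0 1).

Lemma std_normal_pdfE x : pdf x = normal_peak 1 * expR (- x ^+ 2 / 2).
Proof. by rewrite normal_pdfE ?oner_neq0//= /normal_fun subr0 expr1n. Qed.

Lemma measurable_std_normal_pdf : measurable_fun setT (EFin \o pdf).
Proof. apply/measurable_EFinP; exact: measurable_normal_pdf. Qed.

(** The Radon-Nikodym derivative of the Gaussian law and [pdf] have the same integral over every
    measurable set, hence agree almost everywhere. *)
Lemma integral_std_normal (f : R -> \bar R) : (forall x, 0 <= f x)%E ->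
  measurable_fun setT f ->
  (\int[gauss]_x f x = \int[mu]_x (f x * (pdf x)%:E))%E.
Proof.
move=> f0 mf.
have dom := normal_prob_dominates (0:R) 1.
rewrite -(Radon_Nikodym_SigmaFinite.change_of_variables dom)//.
have imk := Radon_Nikodym_SigmaFinite.f_integrable dom.
apply: ae_eq_integral => //.
- by apply: emeasurable_funM => //; exact: (measurable_int mu).
- by apply: emeasurable_funM => //; exact: measurable_std_normal_pdf.
- apply: ae_eqe_mul2l => /=.
  apply: integral_ae_eq => //=.
  + exact: measurable_std_normal_pdf.
  + by move=> E _ mE; rewrite -Radon_Nikodym_SigmaFinite.f_integral.
Qed.

(** Lebesgue measure is determined by its values on half-open intervals, whose lengths a translation
    preserves. Packing the map as a measurable function makes the pushforward a measure, to which
    uniqueness applies. *)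
Lemma lebesgue_measure_shift (a : R) (A : set R) : measurable A ->
  pushforward mu ((fun x => x + a) : measurableTypeR R -> measurableTypeR R) A = mu A.
Proof.
have mh : measurable_fun setT
  ((fun x => x + a) : measurableTypeR R -> measurableTypeR R).
  exact: measurable_funD.
pose h : {mfun measurableTypeR R >-> measurableTypeR R} :=
  HB.pack (fun x : measurableTypeR R => x + a) (isMeasurableFun.Build _ _ _ _ _ mh).
move=> mA; apply/esym; rewrite -[RHS]/(pushforward mu h A).
apply: lebesgue_measure_unique => //= _ [[x y]] _ <-.
rewrite /pushforward/=.
rewrite (_ : _ @^-1` _ = `]x - a, y - a]%classic); last first.
  by apply/seteqP; split=> z /=; rewrite !in_itv/= ltrBlDr lerBrDr.
rewrite !lebesgue_measure_itv/= !lte_fin ltrD2r; case: ifP => // _.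
by rewrite -!EFinD; congr (_%:E); ring.
Qed.

Lemma integral_lebesgue_shift (a : R) (f : R -> \bar R) : (forall x, 0 <= f x)%E ->
  measurable_fun setT f -> (\int[mu]_x f (x + a)%R = \int[mu]_x f x)%E.
Proof.
move=> f0 mf.
pose h : measurableTypeR R -> measurableTypeR R := fun x => x + a.
have mh : measurable_fun setT h by exact: measurable_funD.
transitivity (\int[pushforward mu h]_x f x)%E.
  by rewrite ge0_integral_pushforward.
by apply: eq_measure_integral => A mA _; exact: lebesgue_measure_shift.
Qed.

Lemma integral_lebesgue_opp (f : R -> \bar R) : (forall x, 0 <= f x)%E ->
  measurable_fun setT f -> (\int[mu]_x f (- x)%R = \int[mu]_x f x)%E.
Proof.
move=> f0 mf.
pose h : measurableTypeR R -> measurableTypeR R := -%R.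
have mh : measurable_fun setT h by exact: oppr_measurable.
transitivity (\int[pushforward mu h]_x f x)%E.
  by rewrite ge0_integral_pushforward.
by apply: eq_measure_integral => A mA _; exact: lebesgue_measureN.
Qed.

Lemma integral_std_normal_opp (f : R -> \bar R) : (forall x, 0 <= f x)%E ->
  measurable_fun setT f -> (\int[gauss]_x f (- x)%R = \int[gauss]_x f x)%E.
Proof.
move=> f0 mf; rewrite !integral_std_normal//; last first.
  by apply: measurableT_comp => //; exact: oppr_measurable.
rewrite -[RHS]integral_lebesgue_opp; last 2 first.
- by move=> x; rewrite mule_ge0// lee_fin normal_pdf_ge0.
- by apply: emeasurable_funM => //; exact: measurable_std_normal_pdf.
by apply: eq_integral => x _; rewrite !std_normal_pdfE sqrrN.
Qed.

End GaussianLine.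

(** * Shears and rotations of the plane *)

Section GaussianPlane.
Context {R : realType}.
Local Notation mu := (@lebesgue_measure R).
Local Notation gauss := (@normal_prob R 0 1).
Local Notation pdf := (@normal_pdf R 0 1).
Local Notation plane := (measurableTypeR R * measurableTypeR R)%type.

Lemma integral_lebesgue_shear1 (a : R) (f : R * R -> \bar R) :
  (forall x, 0 <= f x)%E -> measurable_fun setT (f : plane -> _) ->
  (\int[mu]_x \int[mu]_y f (x, (y + a * x)%R) = \int[mu]_x \int[mu]_y f (x, y))%E.
Proof.
move=> f0 mf; apply: eq_integral => x _.
rewrite (integral_lebesgue_shift (a * x) (fun y => f (x, y)))//.
by apply: measurableT_comp => //; exact: pair1_measurable.
Qed.

Lemma measurable_fun_linear2 (a b c e : R) (f : R * R -> \bar R) :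
  measurable_fun setT (f : plane -> _) ->
  measurable_fun setT
    ((fun p => f (a * p.1 + b * p.2, c * p.1 + e * p.2)) : plane -> _).
Proof.
move=> mf.
pose h : plane -> plane := fun p => (a * p.1 + b * p.2, c * p.1 + e * p.2).
have mh : measurable_fun setT h.
  apply/measurable_fun_pairP; split;
    by apply: measurable_funD => //=; apply: measurable_funM.
by have := measurableT_comp mf mh.
Qed.

(** Exchanging the order of integration turns this shear into a translation of the inner
    variable. *)
Lemma integral_lebesgue_shear2 (a : R) (f : R * R -> \bar R) :
  (forall x, 0 <= f x)%E -> measurable_fun setT (f : plane -> _) ->
  (\int[mu]_x \int[mu]_y f ((x + a * y)%R, y) = \int[mu]_x \int[mu]_y f (x, y))%E.
Proof.
move=> f0 mf.
pose h : plane -> _ := fun p => f (1 * p.1 + a * p.2, 0 * p.1 + 1 * p.2).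
have hE x y : h (x, y) = f (x + a * y, y) by rewrite /h/= !mul1r mul0r add0r.
transitivity (\int[mu]_x \int[mu]_y h (x, y))%E.
  by apply: eq_integral => x _; apply: eq_integral => y _; rewrite hE.
have mh : measurable_fun setT h by exact: measurable_fun_linear2.
transitivity (\int[mu]_y \int[mu]_x h (x, y))%E.
  by apply: fubini_tonelli mh _ => p; exact: f0.
transitivity (\int[mu]_y \int[mu]_x f (x, y))%E; last first.
  by apply/esym/(fubini_tonelli (f : plane -> _) mf).
apply: eq_integral => y _.
rewrite -(integral_lebesgue_shift (a * y) (fun x => f (x, y))).
- by apply: eq_integral => x _; rewrite hE.
- by move=> x; exact: f0.
- by apply: (measurableT_comp mf); exact: pair2_measurable.
Qed.

(* With t = s / (1 + c) the rotation [c, -s; s, c] is the product of three shears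
   [1, -t; 0, 1] [1, 0; s, 1] [1, -t; 0, 1]. *)
Lemma integral_lebesgue_rotation (c s : R) (f : R * R -> \bar R) :
  (forall x, 0 <= f x)%E -> measurable_fun setT (f : plane -> _) ->
  c ^+ 2 + s ^+ 2 = 1 -> 1 + c != 0 ->
  (\int[mu]_x \int[mu]_y f ((c * x + (- s) * y)%R, (s * x + c * y)%R)
    = \int[mu]_x \int[mu]_y f (x, y))%E.
Proof.
move=> f0 mf cs1 c1; pose t := s / (1 + c).
pose f1 p := f (1 * p.1 + (- t) * p.2, 0 * p.1 + 1 * p.2).
pose f2 p := f1 (1 * p.1 + 0 * p.2, s * p.1 + 1 * p.2).
have mf1 : measurable_fun setT (f1 : plane -> _) by exact: measurable_fun_linear2.
have mf2 : measurable_fun setT (f2 : plane -> _) by exact: measurable_fun_linear2.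
transitivity (\int[mu]_x \int[mu]_y f2 ((x + (- t) * y)%R, y))%E.
  apply: eq_integral => x _; apply: eq_integral => y _.
  (* Both identities follow from s ^ 2 = (1 - c) (1 + c); they turn the entries of the product of
     shears into [c] and [s]. *)
  have e1 : t * s = 1 - c.
    apply: (mulIf c1); rewrite /t.
    transitivity (s ^+ 2); first by field.
    by have -> : s ^+ 2 = 1 - c ^+ 2; [rewrite -cs1; ring|ring].
  have e2 : t * (1 + c) = s by rewrite /t; field.
  rewrite /f2 /f1 /=; congr (f (_, _)).
    transitivity ((1 - t * s) * x - t * (1 + (1 - t * s)) * y); last by ring.
    by rewrite e1 subKr e2 mulNr.
  by transitivity (s * x + (1 - t * s) * y); [rewrite e1 subKr|ring].
transitivity (\int[mu]_x \int[mu]_y f2 (x, y))%E.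
  by apply: integral_lebesgue_shear2 mf2 => p; exact: f0.
transitivity (\int[mu]_x \int[mu]_y f1 (x, (y + s * x)%R))%E.
  apply: eq_integral => x _; apply: eq_integral => y _.
  by rewrite /f2/=; congr (f1 (_, _)); ring.
transitivity (\int[mu]_x \int[mu]_y f1 (x, y))%E.
  by apply: integral_lebesgue_shear1 mf1 => p; exact: f0.
transitivity (\int[mu]_x \int[mu]_y f ((x + (- t) * y)%R, y))%E.
  apply: eq_integral => x _; apply: eq_integral => y _.
  by rewrite /f1/=; congr (f (_, _)); ring.
exact: integral_lebesgue_shear2.
Qed.

Lemma integral_std_normal2 (f : R * R -> \bar R) : (forall x, 0 <= f x)%E ->
  measurable_fun setT (f : plane -> _) ->
  (\int[gauss]_x \int[gauss]_y f (x, y) =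
   \int[mu]_x \int[mu]_y (f (x, y) * (pdf x * pdf y)%:E))%E.
Proof.
move=> f0 mf; rewrite integral_std_normal//; last 2 first.
- by move=> x; exact: integral_ge0.
- exact: (measurable_fun_fubini_tonelli_F (m2 := gauss)).
apply: eq_integral => x _; rewrite integral_std_normal//; last first.
  by apply: measurableT_comp => //; exact: pair1_measurable.
rewrite -ge0_integralZr//=.
- by apply: eq_integral => y _; rewrite -muleA -EFinM mulrC.
- apply: emeasurable_funM; last exact: measurable_std_normal_pdf.
  by apply: measurableT_comp => //; exact: pair1_measurable.
- by move=> y _; rewrite mule_ge0// lee_fin normal_pdf_ge0.
- by rewrite lee_fin normal_pdf_ge0.
Qed.

(** The product density depends only on x ^ 2 + y ^ 2, which the rotation fixes, so the invariance
    of Lebesgue measure carries over. *)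
Lemma integral_std_normal_rotation (c s : R) (f : R * R -> \bar R) :
  (forall x, 0 <= f x)%E -> measurable_fun setT (f : plane -> _) ->
  c ^+ 2 + s ^+ 2 = 1 -> 1 + c != 0 ->
  (\int[gauss]_x \int[gauss]_y f ((c * x + (- s) * y)%R, (s * x + c * y)%R)
    = \int[gauss]_x \int[gauss]_y f (x, y))%E.
Proof.
move=> f0 mf cs1 c1.
pose fr p := f (c * p.1 + (- s) * p.2, s * p.1 + c * p.2).
have mfr : measurable_fun setT (fr : plane -> _) by exact: measurable_fun_linear2.
pose g p := (f p * (pdf p.1 * pdf p.2)%:E)%E.
transitivity (\int[gauss]_x \int[gauss]_y fr (x, y))%E; first by [].
have fr0 p : (0 <= fr p)%E by exact: f0.
rewrite (integral_std_normal2 _ fr0 mfr) (integral_std_normal2 _ f0 mf).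
have g0 p : (0 <= g p)%E.
  by rewrite mule_ge0// lee_fin mulr_ge0 ?normal_pdf_ge0.
have mg : measurable_fun setT (g : plane -> _).
  apply: emeasurable_funM => //.
  apply/measurable_EFinP/measurable_funM;
  by apply: measurableT_comp => //; exact: measurable_normal_pdf.
transitivity (\int[mu]_x \int[mu]_y g (x, y))%E; last by [].
rewrite -(integral_lebesgue_rotation _ _ _ g0 mg cs1 c1).
apply: eq_integral => x _; apply: eq_integral => y _.
rewrite /fr /g/=; congr (_ * _%:E)%E; rewrite !std_normal_pdfE.
rewrite mulrACA [RHS]mulrACA -!expRD; congr (_ * expR _).
rewrite -mulrDl -[RHS]mulrDl; congr (_ / _).
transitivity (- ((c ^+ 2 + s ^+ 2) * (x ^+ 2 + y ^+ 2))); last by ring.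
by rewrite cs1; ring.
Qed.

End GaussianPlane.

(** * Laws of standard Gaussian vectors *)

(** The product rule of [mutually_indep] speaks about these sets. They are stable under
    intersection, so on the sigma-algebra they generate a finite measure is determined by its values
    on them. *)
Definition rect {R : realType} {d : nat} (b : 'I_d -> set R) : set ('I_d -> R) :=
  [set n | forall i, b i (n i)].

Definition rects {R : realType} {d : nat} : set (set ('I_d -> R)) :=
  [set rect b | b in [set b | forall i, measurable (b i)]].

Notation vec R d := (g_sigma_algebraType (@rects R d)).

Section Vectors.
Context {R : realType} {d : nat}.
Local Notation V := (vec R d).

Lemma measurable_rect (b : 'I_d -> set R) :
  (forall i, measurable (b i)) -> measurable (rect b : set V).
Proof. by move=> mb; apply: sub_sigma_algebra; exists b. Qed.

Lemma measurable_coord (i : 'I_d) : measurable_fun setT (fun n : V => n i).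
Proof.
move=> _ B mB; rewrite setTI.
rewrite (_ : _ @^-1` _ = rect (fun k => if k == i then B else setT)).
  by apply: measurable_rect => k; case: ifP.
apply/seteqP; split=> n /=; first by move=> Bn k; case: eqP => // ->.
by move=> /(_ i); rewrite eqxx.
Qed.

Lemma measurable_fun_vec d1 (T1 : measurableType d1) (f : T1 -> V) :
  (forall i, measurable_fun setT (fun x => f x i)) -> measurable_fun setT f.
Proof.
move=> mf; apply: (@measurability _ _ T1 V setT f (@rects R d) erefl) => _ [_ [b mb <-] <-].
rewrite setTI (_ : _ @^-1` _ = \bigcap_(i in [set: 'I_d]) ((fun x => f x i) @^-1` b i)).
  apply: fin_bigcap_measurable => // i _.
  by rewrite -[X in measurable X]setTI; exact: mf.
by apply/seteqP; split=> x /=; [move=> h i _; exact: h|move=> h i; exact: h].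
Qed.

Lemma measurable_fun_replace_at d1 (T1 : measurableType d1) (f : T1 -> V) k
    (g : T1 -> R) : measurable_fun setT f -> measurable_fun setT g ->
  measurable_fun setT ((fun x => replace_at (f x) k (g x)) : T1 -> V).
Proof.
move=> mf mg; apply: measurable_fun_vec => i; rewrite /replace_at.
case: (i == k) => //.
by have := measurableT_comp (measurable_coord i) mf.
Qed.

Lemma measurable_matvec (Q : 'M[R]_d) i : measurable_fun setT (fun n : V => matvec Q n i).
Proof.
apply: measurable_sum => k; apply: measurable_funM => //; exact: measurable_coord.
Qed.

Lemma measurable_fun_matvec d1 (T1 : measurableType d1) (Q : 'M[R]_d) (f : T1 -> V) :
  measurable_fun setT f -> measurable_fun setT ((fun x => matvec Q (f x)) : T1 -> V).
Proof.
move=> mf; apply: measurable_fun_vec => i.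
by have := measurableT_comp (measurable_matvec Q i) mf.
Qed.

Lemma vec_measure_unique (m1 m2 : {measure set V -> \bar R}) :
  (forall b : 'I_d -> set R, (forall i, measurable (b i)) -> m1 (rect b) = m2 (rect b)) ->
  (m1 setT < +oo)%E -> forall A, measurable A -> m1 A = m2 A.
Proof.
move=> m12 m1fin; apply: (@measure_unique _ R V (@rects R d) (fun=> setT) erefl) => //.
- move=> _ _ [b1 mb1 <-] [b2 mb2 <-].
  exists (fun i => b1 i `&` b2 i); first by move=> i; exact: measurableI.
  apply/seteqP; split=> n /=.
    by move=> h; split=> i; have [] := h i.
  by move=> [h1 h2] i; split.
- by move=> _; exists (fun=> setT) => //; apply/seteqP.
- exact: bigcup_const.
- by move=> _ [b mb <-]; exact: m12.
Qed.

(** Agreement on rectangles gives equal pushforwards. The two source spaces may differ, so that [P]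
    can be compared with a product measure as well as with restrictions and multiples of itself. *)
Lemma eq_law_integral d1 d2 (T1 : measurableType d1) (T2 : measurableType d2)
    (m1 : {measure set T1 -> \bar R}) (m2 : {measure set T2 -> \bar R})
    (f1 : T1 -> V) (f2 : T2 -> V) (h : V -> \bar R) :
  measurable_fun setT f1 -> measurable_fun setT f2 ->
  (forall b : 'I_d -> set R, (forall i, measurable (b i)) ->
     m1 [set x | rect b (f1 x)] = m2 [set x | rect b (f2 x)]) ->
  (m1 setT < +oo)%E ->
  measurable_fun setT h -> (forall n, 0 <= h n)%E ->
  (\int[m1]_x h (f1 x) = \int[m2]_x h (f2 x))%E.
Proof.
move=> mf1 mf2 m12 m1fin mh h0.
pose g1 : {mfun T1 >-> V} := HB.pack f1 (isMeasurableFun.Build _ _ _ _ _ mf1).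
pose g2 : {mfun T2 >-> V} := HB.pack f2 (isMeasurableFun.Build _ _ _ _ _ mf2).
transitivity (\int[pushforward m1 g1]_n h n)%E.
  by rewrite (ge0_integral_pushforward mf1).
transitivity (\int[pushforward m2 g2]_n h n)%E; last first.
  by rewrite (ge0_integral_pushforward mf2).
by apply: eq_measure_integral => A mA _; apply: vec_measure_unique.
Qed.

End Vectors.

(** * Replacing coordinates by fresh Gaussians *)

Section Resampling.
Context {R : realType} {d : nat}.
Context {dT : measure_display} {T : measurableType dT} (P : probability T R).
Local Notation V := (vec R d).
Local Notation gauss := (@normal_prob R 0 1).

Definition iid_std_normal (X : T -> 'I_d -> R) : Prop :=
  measurable_fun setT (X : T -> V) /\
  forall b : 'I_d -> set R, (forall i, measurable (b i)) ->
    P [set w | rect b (X w)] = (\prod_i fine (gauss (b i)))%:E.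

Lemma iid_std_normal_eq (X Y : T -> 'I_d -> R) (h : V -> \bar R) :
  iid_std_normal X -> iid_std_normal Y ->
  measurable_fun setT h -> (forall n, 0 <= h n)%E ->
  (\int[P]_w h (X w) = \int[P]_w h (Y w))%E.
Proof.
move=> [mX lX] [mY lY] mh h0; apply: eq_law_integral => //.
- by move=> b mb; apply: (etrans (lX b mb)); apply/esym/lY.
- exact: (le_lt_trans (probability_le1 P measurableT) (ltry _)).
Qed.

(** Overwriting entry [k] by an independent Gaussian leaves the law unchanged. This is what makes
    [Zcond], an integral over one coordinate, a conditional probability. *)
Lemma integral_resample (X : T -> 'I_d -> R) (k : 'I_d) (h : V -> \bar R) :
  iid_std_normal X -> measurable_fun setT h -> (forall n, 0 <= h n)%E ->
  (\int[P]_w h (X w) = \int[P]_w \int[gauss]_t h (replace_at (X w) k t))%E.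
Proof.
move=> [mX lX] mh h0.
pose psi (p : T * measurableTypeR R) : V := replace_at (X p.1) k p.2.
have mpsi : measurable_fun setT psi.
  have mX1 : measurable_fun setT (fun p : T * measurableTypeR R => (X p.1 : V)).
    exact: (measurableT_comp mX measurable_fst).
  exact: measurable_fun_replace_at.
have mhpsi : measurable_fun setT (fun p => h (psi p)).
  by have := measurableT_comp mh mpsi.
transitivity (\int[P \x gauss]_p h (psi p))%E; last first.
  by rewrite fubini_tonelli1.
apply: eq_law_integral => //; last exact: (le_lt_trans (probability_le1 P measurableT) (ltry _)).
move=> b mb; apply: (etrans (lX b mb)); apply/esym.
(* Freeing coordinate [k] makes the preimage of the rectangle a product set, whose product measure
   is explicit. *)
pose b' i := if i == k then setT else b i.
have mb' i : measurable (b' i) by rewrite /b'; case: ifP.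
rewrite (_ : [set p | rect b (psi p)] = [set w | rect b' (X w)] `*` b k); last first.
  apply/seteqP; split=> -[w t] /=.
    move=> h1; split.
      by move=> i; rewrite /b'; case: eqP => // /eqP ik; have := h1 i;
        rewrite /psi/= /replace_at (negbTE ik).
    by have := h1 k; rewrite /psi/= /replace_at eqxx.
  move=> [h1 h2] i; rewrite /psi/= /replace_at; case: eqP => [->//|/eqP ik].
  by have := h1 i; rewrite /b' (negbTE ik).
have mXb' : measurable [set w | rect b' (X w)].
  by rewrite -[X in measurable X]setTI; apply: (mX _ (rect b')) => //; exact: measurable_rect.
apply: (etrans (product_measure1E P gauss mXb' (mb k))).
apply: (etrans (congr1 (fun x => x * _)%E (lX b' mb'))).
rewrite (bigD1 k)//= [in RHS](bigD1 k)//= {1}/b' eqxx probability_setT/= mul1r.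
have gk : gauss (b k) = (fine (gauss (b k)))%:E.
  by apply/esym/fineK; have := @fin_num_measure _ _ _ (normal_prob 0 1) _ (mb k).
rewrite [in LHS]gk -EFinM mulrC; congr (_ * _)%:E.
by apply: eq_bigr => i ik; rewrite /b' (negbTE ik).
Qed.

Lemma measurable_fun_resample (k : 'I_d) (h : V -> \bar R) :
  measurable_fun setT h -> (forall n, 0 <= h n)%E ->
  measurable_fun setT ((fun n => \int[gauss]_t h (replace_at n k t))%E : V -> \bar R).
Proof.
move=> mh h0.
pose psi (p : V * measurableTypeR R) : V := replace_at p.1 k p.2.
have mpsi : measurable_fun setT psi by exact: measurable_fun_replace_at.
exact: (measurable_fun_fubini_tonelli_F (h \o psi) (measurableT_comp mh mpsi)
  (fun p => h0 (psi p))).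
Qed.

(** Freeing two coordinates exposes a double Gaussian integral, so that a rotation of entries [k]
    and [l] becomes a rotation of the integration variables. *)
Lemma integral_resample2 (X : T -> 'I_d -> R) (k l : 'I_d) (h : V -> \bar R) :
  iid_std_normal X -> measurable_fun setT h -> (forall n, 0 <= h n)%E ->
  (\int[P]_w h (X w) = \int[P]_w \int[gauss]_s \int[gauss]_t
     h (replace_at (replace_at (X w) k s) l t))%E.
Proof.
move=> iX mh h0; apply: (etrans (integral_resample _ l _ iX mh h0)).
apply: (integral_resample _ k (fun n => \int[gauss]_t h (replace_at n l t))%E) => //.
- exact: measurable_fun_resample.
- by move=> n; exact: integral_ge0.
Qed.

Lemma iid_std_normal_map (X : T -> 'I_d -> R) (f : ('I_d -> R) -> 'I_d -> R) :
  iid_std_normal X -> measurable_fun setT (f : V -> V) ->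
  (forall h : V -> \bar R, measurable_fun setT h -> (forall n, 0 <= h n)%E ->
     (\int[P]_w h (f (X w)) = \int[P]_w h (X w))%E) ->
  iid_std_normal (f \o X).
Proof.
move=> [mX lX] mf fE.
have mfX : measurable_fun setT (f \o X : T -> V) by have := measurableT_comp mf mX.
split=> // b mb; rewrite -lX//.
pose g (n : V) : \bar R := (\1_(rect b) n)%:E.
have mg : measurable_fun setT g.
  by apply/measurable_EFinP; apply: measurable_indic; exact: measurable_rect.
have gE (Y : T -> V) : measurable_fun setT Y ->
    (\int[P]_w g (Y w) = P [set w | rect b (Y w)])%E.
  move=> mY; have mS : measurable [set w | rect b (Y w)].
    by rewrite -[X in measurable X]setTI; apply: (mY _ (rect b)) => //; exact: measurable_rect.
  by apply: (etrans (integral_indic P measurableT mS)); rewrite setIT.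
have := fE g mg; rewrite (gE (f \o X))// gE//; apply.
by move=> n; rewrite lee_fin.
Qed.

(** Both new entries are computed from the original [n], not from the partially updated vector. *)
Definition rotate (k l : 'I_d) (c s : R) (n : 'I_d -> R) : 'I_d -> R :=
  replace_at (replace_at n k (c * n k + (- s) * n l)) l (s * n k + c * n l).

Definition flip (k : 'I_d) (n : 'I_d -> R) : 'I_d -> R := replace_at n k (- n k).

Lemma iid_std_normal_rotate (X : T -> 'I_d -> R) (k l : 'I_d) (c s : R) : k != l ->
  c ^+ 2 + s ^+ 2 = 1 -> 1 + c != 0 ->
  iid_std_normal X -> iid_std_normal (rotate k l c s \o X).
Proof.
move=> kl cs1 c1 iX.
have mrot : measurable_fun setT (rotate k l c s : V -> V).
  apply: measurable_fun_replace_at; last first.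
    by apply: measurable_funD; apply: measurable_funM => //; exact: measurable_coord.
  apply: measurable_fun_replace_at => //.
  by apply: measurable_funD; apply: measurable_funM => //; exact: measurable_coord.
apply: iid_std_normal_map => // h mh h0.
have mhr : measurable_fun setT (fun n : V => h (rotate k l c s n)).
  by have := measurableT_comp mh mrot.
apply: (etrans (integral_resample2 _ k l _ iX mhr (fun n => h0 _))).
apply/esym; apply: (etrans (integral_resample2 _ k l _ iX mh h0)); apply/esym.
apply: eq_integral => w _.
pose f (p : measurableTypeR R * measurableTypeR R) :=
  h (replace_at (replace_at (X w) k p.1) l p.2).
have mf : measurable_fun setT f.
  apply: (measurableT_comp mh); apply: measurable_fun_replace_at => //.
  exact: measurable_fun_replace_at.
apply: etrans (integral_std_normal_rotation c s f (fun p => h0 _) mf cs1 c1).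
apply: eq_integral => x _; apply: eq_integral => y _.
rewrite /f/=; congr h; apply/funext => i; rewrite /rotate /replace_at.
by rewrite !eqxx (negbTE kl); case: (i == l) => //; case: (i == k).
Qed.

Lemma iid_std_normal_flip (X : T -> 'I_d -> R) (k : 'I_d) :
  iid_std_normal X -> iid_std_normal (flip k \o X).
Proof.
move=> iX.
have mflip : measurable_fun setT (flip k : V -> V).
  apply: measurable_fun_replace_at => //.
  by have := measurableT_comp (@oppr_measurable R setT) (measurable_coord k).
apply: iid_std_normal_map => // h mh h0.
have mhr : measurable_fun setT (fun n : V => h (flip k n)).
  by have := measurableT_comp mh mflip.
apply: (etrans (integral_resample _ k _ iX mhr (fun n => h0 _))).
apply/esym; apply: (etrans (integral_resample _ k _ iX mh h0)); apply/esym.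
apply: eq_integral => w _.
have mf : measurable_fun setT (fun t : R => h (replace_at (X w) k t)).
  by apply: (measurableT_comp mh); exact: measurable_fun_replace_at.
apply: etrans (integral_std_normal_opp _ (fun t => h0 _) mf).
apply: eq_integral => t _; congr h; apply/funext => i; rewrite /flip /replace_at.
by rewrite eqxx; case: (i == k).
Qed.

End Resampling.

(** * Orthogonal invariance by elimination *)

Section Orthogonal.
Context {R : realType} {d : nat}.
Context {dT : measure_display} {T : measurableType dT} (P : probability T R).

(** Quantifying over every vector [X] on the space makes the property stable under matrix
    products. *)
Definition preserves_iid_std_normal (Q : 'M[R]_d) : Prop :=
  forall X : T -> 'I_d -> R,
    iid_std_normal P X -> iid_std_normal P (fun w => matvec Q (X w)).

Lemma matvecM (A B : 'M[R]_d) n : matvec (A *m B) n = matvec A (matvec B n).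
Proof.
apply/funext => i; rewrite /matvec.
under eq_bigr do rewrite mxE mulr_suml.
rewrite exchange_big; apply: eq_bigr => k _; rewrite mulr_sumr.
by apply: eq_bigr => j _; rewrite mulrA.
Qed.

Lemma matvec1 n : matvec (1%:M : 'M[R]_d) n = n.
Proof.
apply/funext => i; rewrite /matvec (bigD1 i)//= mxE eqxx mul1r big1 ?addr0//.
by move=> k ki; rewrite mxE eq_sym (negbTE ki) mul0r.
Qed.

Lemma preserves_iidM (A B : 'M[R]_d) : preserves_iid_std_normal A ->
  preserves_iid_std_normal B -> preserves_iid_std_normal (A *m B).
Proof.
move=> iA iB X iX.
rewrite (_ : (fun w => _) = (fun w => matvec A (matvec B (X w)))).
  exact: (iA (fun w => matvec B (X w))) (iB _ iX).
by apply/funext => w; rewrite matvecM.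
Qed.

Definition rotate_mx (k l : 'I_d) (c s : R) : 'M[R]_d := \matrix_(i, j)
  (if i == k then c * (j == k)%:R - s * (j == l)%:R
   else if i == l then s * (j == k)%:R + c * (j == l)%:R else (i == j)%:R).

Definition flip_mx (k : 'I_d) : 'M[R]_d :=
  \matrix_(i, j) (if i == k then - (i == j)%:R else (i == j)%:R).

Lemma sum_delta (k : 'I_d) (n : 'I_d -> R) : \sum_j (j == k)%:R * n j = n k.
Proof.
rewrite (bigD1 k)//= eqxx mul1r big1 ?addr0// => j /negbTE ->.
by rewrite mul0r.
Qed.

Lemma sum_deltaC (k : 'I_d) (n : 'I_d -> R) : \sum_j (k == j)%:R * n j = n k.
Proof. by rewrite -[RHS]sum_delta; apply: eq_bigr => j _; rewrite eq_sym. Qed.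

Lemma matvec_rotate k l c s n : k != l ->
  matvec (rotate_mx k l c s) n = rotate k l c s n.
Proof.
move=> kl; apply/funext => i; rewrite /matvec /rotate /replace_at.
under eq_bigr do rewrite mxE.
case: (eqVneq i k) => [->|ik].
  rewrite (negbTE kl); under eq_bigr do rewrite mulrBl -!mulrA.
  by rewrite sumrB -!mulr_sumr !sum_delta mulNr.
case: (eqVneq i l) => [_|il]; last exact: sum_deltaC.
under eq_bigr do rewrite mulrDl -!mulrA.
by rewrite big_split/= -!mulr_sumr !sum_delta.
Qed.

Lemma matvec_flip k n : matvec (flip_mx k) n = flip k n.
Proof.
apply/funext => i; rewrite /matvec /flip /replace_at.
under eq_bigr do rewrite mxE.
case: (eqVneq i k) => [->|ik]; last exact: sum_deltaC.
under eq_bigr do rewrite mulNr.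
by rewrite sumrN sum_deltaC.
Qed.

Lemma mulmx_matvec (A B : 'M[R]_d) i j : (A *m B) i j = matvec A (B^~ j) i.
Proof. by rewrite mxE. Qed.

Lemma tr_rotate k l c s : k != l -> (rotate_mx k l c s)^T = rotate_mx k l c (- s).
Proof.
move=> kl; have lk : l != k by rewrite eq_sym.
apply/matrixP => i j; rewrite !mxE.
case: (eqVneq i k) => [->|ik]; case: (eqVneq j k) => [->|jk];
  rewrite ?eqxx ?(negbTE kl) ?(negbTE lk) ?(negbTE ik) ?(negbTE jk).
- by rewrite /=; ring.
- by case: (eqVneq j l) => _ /=; ring.
- by case: (eqVneq i l) => _ /=; ring.
case: (boolP (i == l)) => il; case: (boolP (j == l)) => jl.
- by rewrite /=; ring.
- by rewrite (eqP il) (negbTE jl)/=; ring.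
- by rewrite (eqP jl) (negbTE il)/=; ring.
- by rewrite eq_sym.
Qed.

Lemma matvec_id_mx (A : 'M[R]_d) : (forall n, matvec A n = n) -> A = 1%:M.
Proof.
move=> E; apply/matrixP => i j; have -> : A i j = (A *m 1%:M) i j by rewrite mulmx1.
by rewrite mulmx_matvec E.
Qed.

Lemma tr_flip k : (flip_mx k)^T = flip_mx k.
Proof.
apply/matrixP => i j; rewrite !mxE (eq_sym j i).
case: (eqVneq i j) => [->//|ij].
by rewrite !oppr0 !if_same.
Qed.

Lemma rotate_mx_orth k l c s : k != l -> c ^+ 2 + s ^+ 2 = 1 ->
  (rotate_mx k l c s)^T *m rotate_mx k l c s = 1%:M.
Proof.
move=> kl cs1; rewrite tr_rotate//.
have lk : l != k by rewrite eq_sym.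
apply: matvec_id_mx => n.
rewrite matvecM !matvec_rotate//; apply/funext => i; rewrite /rotate /replace_at.
rewrite !eqxx (negbTE kl).
case: (eqVneq i l) => [->|il].
  transitivity ((c ^+ 2 + s ^+ 2) * n l); first by ring.
  by rewrite cs1 mul1r.
case: (eqVneq i k) => [->|ik] //.
transitivity ((c ^+ 2 + s ^+ 2) * n k); first by ring.
by rewrite cs1 mul1r.
Qed.

Lemma flip_mx_orth k : (flip_mx k)^T *m flip_mx k = 1%:M.
Proof.
rewrite tr_flip.
apply: matvec_id_mx => n.
rewrite matvecM !matvec_flip; apply/funext => i; rewrite /flip /replace_at eqxx.
by case: (eqVneq i k) => [->|//]; rewrite opprK.
Qed.

Lemma preserves_iid_rotate k l c s : k != l -> c ^+ 2 + s ^+ 2 = 1 -> 1 + c != 0 ->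
  preserves_iid_std_normal (rotate_mx k l c s).
Proof.
move=> kl cs1 c1 X iX.
rewrite (_ : (fun w => _) = rotate k l c s \o X); first exact: iid_std_normal_rotate.
by apply/funext => w; rewrite matvec_rotate.
Qed.

Lemma preserves_iid_flip k : preserves_iid_std_normal (flip_mx k).
Proof.
move=> X iX; rewrite (_ : (fun w => _) = flip k \o X); first exact: iid_std_normal_flip.
by apply/funext => w; rewrite matvec_flip.
Qed.

Lemma orth_row_norm (Q : 'M[R]_d) i : Q *m Q^T = 1%:M -> \sum_j Q i j ^+ 2 = 1.
Proof.
move=> /matrixP/(_ i i); rewrite !mxE eqxx mulr1n => <-.
by apply: eq_bigr => j _; rewrite mxE expr2.
Qed.

Lemma orth_row_delta (Q : 'M[R]_d) i j : Q *m Q^T = 1%:M -> Q i i = 1 ->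
  j != i -> Q i j = 0.
Proof.
move=> /(orth_row_norm _ i) + Qii ji; rewrite (bigD1 i)//= Qii expr1n => /eqP.
rewrite -subr_eq0 addrAC subrr add0r psumr_eq0; last by move=> k _; exact: sqr_ge0.
by move=> /allP/(_ j); rewrite mem_index_enum ji/= sqrf_eq0 => /(_ isT)/eqP.
Qed.

Lemma mulmx_orth (G Q : 'M[R]_d) : G^T *m G = 1%:M -> Q *m Q^T = 1%:M ->
  (G *m Q) *m (G *m Q)^T = 1%:M.
Proof.
by move=> G1 Q1; rewrite trmx_mul -mulmxA (mulmxA Q) Q1 mul1mx; exact: mulmx1C.
Qed.

(** Invariant of the elimination: it records the columns already cleared. *)
Definition unit_cols (k : nat) (Q : 'M[R]_d) : Prop :=
  forall i : 'I_d, (i < k)%N -> forall j, Q j i = (j == i)%:R.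

(** Since Q = G^T (G Q), the transpose of each elementary factor has to preserve the law, which is
    why transposes of rotations and flips are computed. *)
Lemma preserves_iid_reduce (G Q : 'M[R]_d) : G^T *m G = 1%:M ->
  preserves_iid_std_normal G^T -> preserves_iid_std_normal (G *m Q) ->
  preserves_iid_std_normal Q.
Proof.
move=> G1 iG iGQ; rewrite -[Q]mul1mx -G1 -mulmxA; exact: preserves_iidM.
Qed.

(* Column k is cleared by rotations in the planes (k, l), leaving +1 or -1 on the diagonal. *)
Lemma preserves_iid_step (k : 'I_d) :
  (forall Q, Q *m Q^T = 1%:M -> unit_cols k.+1 Q -> preserves_iid_std_normal Q) ->
  forall Q, Q *m Q^T = 1%:M -> unit_cols k Q -> preserves_iid_std_normal Q.
Proof.
move=> IH Q; have [m] := ubnP #|[set j | (j != k) && (Q j k != 0)]%SET|.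
elim: m Q => // m IHm Q; rewrite ltnS => cm Q1 uQ.
(* A cleared column [i] puts 1 on the diagonal of a row of norm 1, so row [i] vanishes elsewhere.
   Hence the [l] picked below is not an earlier index, and the rotation leaves cleared columns
   intact. *)
have Qrow0 (i : 'I_d) : (i < k)%N -> Q i k = 0.
  move=> ik; apply: (orth_row_delta _ _ _ Q1); first by rewrite uQ// eqxx.
  by apply: contraTneq ik => ->; rewrite ltnn.
have [/existsP[l /andP[lk Qlk]]|] := boolP [exists l, (l != k) && (Q l k != 0)].
  have kl : k != l by rewrite eq_sym.
  pose a := Q k k; pose b := Q l k; pose r := Num.sqrt (a ^+ 2 + b ^+ 2).
  have b2 : 0 < b ^+ 2 by rewrite exprn_even_gt0.
  have ab0 : 0 < a ^+ 2 + b ^+ 2 by rewrite ltr_wpDl// sqr_ge0.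
  have r0 : 0 < r by rewrite sqrtr_gt0.
  have r2 : r ^+ 2 = a ^+ 2 + b ^+ 2 by rewrite sqr_sqrtr// ltW.
  have cs1 : (a / r) ^+ 2 + (- b / r) ^+ 2 = 1.
    rewrite !expr_div_n sqrrN -mulrDl -r2 divff// sqrf_eq0 gt_eqF//.
  (* The value excluded by the shear decomposition would force a = - r, hence b = 0. *)
  have c1 : 1 + a / r != 0.
    apply/eqP => e; have ar : a = - r.
      by apply: (mulIf (invr_neq0 (lt0r_neq0 r0))); rewrite mulNr divff ?lt0r_neq0//; lra.
    by move: r2 b2; rewrite ar sqrrN => r2; lra.
  (* This angle sends the pair (a, b) of column [k] to (r, 0). *)
  pose G := rotate_mx k l (a / r) (- b / r).
  have G1 : G^T *m G = 1%:M by exact: rotate_mx_orth.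
  have GQ i j : (G *m Q) i j = rotate k l (a / r) (- b / r) (Q^~ j) i.
    by rewrite mulmx_matvec matvec_rotate.
  apply: (preserves_iid_reduce _ _ G1).
    by rewrite tr_rotate//; apply: preserves_iid_rotate; rewrite // sqrrN.
  apply: IHm.
  - apply: leq_trans cm; apply: proper_card; apply/properP; split.
      apply/fintype.subsetP => i; rewrite !inE => /andP[ik].
      rewrite ik GQ /rotate /replace_at (negbTE ik).
      by case: (eqVneq i l) => [->|//]; rewrite -/b Qlk.
    exists l; rewrite !inE ?lk ?Qlk//= negbK GQ /rotate /replace_at eqxx -/a -/b.
    by apply/eqP; field; rewrite gt_eqF.
  - exact: mulmx_orth.
  - move=> i ik j; rewrite GQ /rotate /replace_at !uQ//.
    have ki : (k == i) = false by apply: contraTF ik => /eqP->; rewrite ltnn.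
    have li : (l == i) = false.
      by apply: contraNF Qlk => /eqP ->; rewrite Qrow0.
    by rewrite ki li !mulr0 addr0; case: (eqVneq j l) => [->|_];
      rewrite ?li//; case: (eqVneq j k) => [->|//]; rewrite ki.
rewrite negb_exists => /forallP H.
have Qk j : j != k -> Q j k = 0.
  by move=> jk; have := H j; rewrite jk/= negbK => /eqP.
have Qkk : Q k k ^+ 2 = 1.
  have Q1' : Q^T *m Q^T^T = 1%:M by rewrite trmxK; exact: mulmx1C.
  have := orth_row_norm _ k Q1'; rewrite (bigD1 k)//= mxE big1 ?addr0//.
  by move=> j jk; rewrite mxE Qk// expr0n.
have Ucols (Q' : 'M[R]_d) : unit_cols k Q' -> (forall j, j != k -> Q' j k = 0) ->
    Q' k k = 1 -> unit_cols k.+1 Q'.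
  move=> uQ' Q'k Q'kk i; rewrite ltnS leq_eqVlt => /predU1P[/val_inj->|ik] j; last exact: uQ'.
  by case: (eqVneq j k) => [->//|jk]; rewrite Q'k.
(* Column [k] is now cleared up to the sign of its diagonal entry; a flip corrects the value -1. *)
move/eqP: Qkk; rewrite sqrf_eq1 => /orP[/eqP Qkk|/eqP Qkk].
  by apply: IH => //; exact: Ucols.
have GQ i j : (flip_mx k *m Q) i j = flip k (Q^~ j) i.
  by rewrite mulmx_matvec matvec_flip.
apply: (preserves_iid_reduce _ _ (flip_mx_orth k)).
  by rewrite tr_flip; exact: preserves_iid_flip.
apply: IH; first by apply: mulmx_orth => //; exact: flip_mx_orth.
apply: Ucols.
- move=> i ik j; rewrite GQ /flip /replace_at !uQ//.
  case: (eqVneq j k) => [->|//].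
  by have -> : (k == i) = false; [apply: contraTF ik => /eqP->; rewrite ltnn|rewrite oppr0].
- by move=> j jk; rewrite GQ /flip /replace_at (negbTE jk) Qk.
- by rewrite GQ /flip /replace_at eqxx Qkk opprK.
Qed.

Lemma preserves_iid_orth (Q : 'M[R]_d) : Q *m Q^T = 1%:M -> preserves_iid_std_normal Q.
Proof.
(* Here [m] counts the columns still to be cleared. *)
suff H (m : nat) : (m <= d)%N -> forall Q, Q *m Q^T = 1%:M -> unit_cols (d - m) Q ->
    preserves_iid_std_normal Q.
  by move=> Q1; apply: (H d (leqnn _)) => //; rewrite subnn => i.
elim: m => [|m IHm] md {}Q Q1.
  rewrite subn0 => uQ X iX.
  have -> : Q = 1%:M by apply/matrixP => i j; rewrite uQ// mxE.
  by rewrite (_ : (fun w => _) = X)//; apply/funext => w; rewrite matvec1.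
have kd : (d - m.+1 < d)%N by rewrite ltn_subrL/= (leq_ltn_trans _ md).
apply: (preserves_iid_step (Ordinal kd)) => //= Q' Q1' uQ'.
by apply: (IHm (ltnW md)) => //; rewrite -subSn// in uQ'.
Qed.

(** The matrix A^-1 B is orthogonal because A A^T = B B^T, and A composed with it is B. *)
Lemma eq_law_factor (A B : 'M[R]_d) (X : T -> 'I_d -> R) (h : vec R d -> \bar R) :
  A \in unitmx -> A *m A^T = B *m B^T -> iid_std_normal P X ->
  measurable_fun setT h -> (forall n, 0 <= h n)%E ->
  (\int[P]_w h (matvec A (X w)) = \int[P]_w h (matvec B (X w)))%E.
Proof.
move=> uA AB iX mh h0; pose Q := invmx A *m B.
have Q1 : Q *m Q^T = 1%:M.
  rewrite trmx_mul -mulmxA (mulmxA B) -AB -(mulmxA A) -trmx_mul mulVmx//.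
  by rewrite trmx1 mulmx1 mulVmx.
have mhA : measurable_fun setT (fun n : vec R d => h (matvec A n)).
  have mA : measurable_fun setT ((fun n => matvec A n) : vec R d -> vec R d).
    by apply: measurable_fun_vec => i; exact: measurable_matvec.
  by have := measurableT_comp mh mA.
apply: (etrans (iid_std_normal_eq _ _ _ _ iX (preserves_iid_orth _ Q1 _ iX) mhA (fun n => h0 _))).
by apply: eq_integral => w _; rewrite -matvecM /Q mulmxA mulmxV// mul1mx.
Qed.

End Orthogonal.

(** * Gaussian tails *)

Section Tail.
Context {R : realType}.
Local Notation mu := (@lebesgue_measure R).
Local Notation gauss := (@normal_prob R 0 1).
Local Notation pdf := (@normal_pdf R 0 1).

Definition tail (x : R) : R := fine (gauss `]x, +oo[).

Lemma gauss_fine (B : set R) : measurable B -> gauss B = (fine (gauss B))%:E.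
Proof. by move=> mB; apply/esym/fineK; exact: fin_num_measure. Qed.

Lemma gauss_ge0 (B : set R) : (0 <= gauss B)%E.
Proof. exact: (measure_ge0 (normal_prob 0 1)). Qed.

Lemma fine_gauss_ge0 (B : set R) : 0 <= fine (gauss B).
Proof. exact/fine_ge0/gauss_ge0. Qed.

Lemma fine_gauss_le1 (B : set R) : measurable B -> fine (gauss B) <= 1.
Proof.
move=> mB; rewrite -lee_fin -gauss_fine//.
by have := @probability_le1 _ _ _ (normal_prob 0 1) _ mB.
Qed.

Lemma fine_gauss_le (A B : set R) : measurable A -> measurable B -> A `<=` B ->
  fine (gauss A) <= fine (gauss B).
Proof.
move=> mA mB AB; rewrite -lee_fin -!gauss_fine//.
by have := @le_measure _ _ _ (normal_prob 0 1) A B; rewrite !inE; exact.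
Qed.

Lemma tailE x : gauss `]x, +oo[ = (tail x)%:E.
Proof. exact: gauss_fine. Qed.

Lemma tail_ge0 x : 0 <= tail x. Proof. exact: fine_gauss_ge0. Qed.

Lemma tail_le1 x : tail x <= 1. Proof. exact: fine_gauss_le1. Qed.

Lemma tail_le x y : x <= y -> tail y <= tail x.
Proof.
move=> xy; apply: fine_gauss_le => // z /=; rewrite !in_itv/= !andbT.
exact: le_lt_trans.
Qed.

Lemma gauss_itvoc x y : x <= y -> fine (gauss `]x, y]) = tail x - tail y.
Proof.
move=> xy; pose A := `]x, y]%classic : set R; pose B := `]y, +oo[%classic : set R.
have mA : measurable A by exact: measurable_itv.
have mB : measurable B by exact: measurable_itv.
have AB : A `&` B = set0.
  apply/seteqP; split=> z //= []; rewrite /A /B /= !in_itv/= andbT => /andP[_ zy].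
  by rewrite ltNge zy.
have E := measureU (normal_prob 0 1) mA mB AB.
have AUB : A `|` B = `]x, +oo[%classic.
  apply/seteqP; split=> z /=; rewrite /A /B /= !in_itv/= !andbT.
    by case=> [/andP[]//|]; exact: le_lt_trans.
  by case: (lerP z y) => zy xz; [left; rewrite xz|right].
apply/eqP; rewrite eq_sym subr_eq; apply/eqP; rewrite /tail -AUB.
by rewrite -fineD ?(fin_num_measure (normal_prob 0 1))//; congr fine.
Qed.

Lemma tail_shift y h :
  gauss `]y + h, +oo[ = (\int[mu]_(s in `]y, +oo[) (pdf (s + h))%:E)%E.
Proof.
rewrite /normal_prob integral_mkcond [RHS]integral_mkcond.
rewrite -(integral_lebesgue_shift h).
- apply: eq_integral => s _; rewrite /patch/=.
  have -> : (s + h \in `]y + h, +oo[%classic) = (s \in `]y, +oo[%classic).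
    by apply/idP/idP; rewrite !inE/= !in_itv/= !andbT ltrD2r.
  by [].
- by move=> s; rewrite /patch; case: ifP => // _; rewrite lee_fin normal_pdf_ge0.
- apply/(measurable_restrictT _ _).1 => //.
  exact: measurable_funTS measurable_std_normal_pdf.
Qed.

Lemma std_normal_pdf_shift s h :
  pdf (s + h) = expR (- (s * h) - h ^+ 2 / 2) * pdf s.
Proof.
rewrite !std_normal_pdfE mulrCA -expRD; congr (_ * expR _).
by field.
Qed.

Lemma integral_itv_pdf (c : R) (B : set R) : measurable B -> 0 <= c ->
  (\int[mu]_(s in B) (c * pdf s)%:E)%E = (c * fine (gauss B))%:E.
Proof.
move=> mB c0; rewrite EFinM -gauss_fine// /normal_prob -ge0_integralZl//.
- exact: measurable_funTS measurable_std_normal_pdf.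
- by move=> s _; rewrite lee_fin normal_pdf_ge0.
Qed.

Lemma measurable_scaled_pdf (c : R) : measurable_fun setT (fun s : R => (c * pdf s)%:E).
Proof.
apply/measurable_EFinP/measurable_funM => //; exact: measurable_normal_pdf.
Qed.

Lemma measurable_shifted_pdf h : measurable_fun setT (fun s : R => (pdf (s + h)%R)%:E).
Proof.
apply: (measurableT_comp measurable_std_normal_pdf).
exact: measurable_funD.
Qed.

(** The ratio of the shifted density to the original one decreases in s, so beyond [y] its value at
    [y] bounds it. *)
Lemma tailD_le y h : 0 <= h -> tail (y + h) <= expR (- (y * h) - h ^+ 2 / 2) * tail y.
Proof.
move=> h0; rewrite -lee_fin -tailE tail_shift /tail -integral_itv_pdf ?expR_ge0//.
apply: ge0_le_integral => //.
- by move=> s _; rewrite lee_fin normal_pdf_ge0.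
- exact: measurable_funTS (measurable_shifted_pdf h).
- exact: measurable_funTS (measurable_scaled_pdf _).
- move=> s; rewrite /= in_itv/= andbT => ys.
  rewrite lee_fin std_normal_pdf_shift ler_wpM2r ?normal_pdf_ge0// ler_expR.
  by rewrite lerB// lerN2 ler_wpM2r// ltW.
Qed.

(** Bounding the density ratio from below requires s bounded above, so only the mass of ]y, y + 1]
    is kept. *)
Lemma tailD_ge y h : 0 <= h ->
  expR (- ((y + 1) * h) - h ^+ 2 / 2) * (tail y - tail (y + 1)) <= tail (y + h).
Proof.
move=> h0; rewrite -gauss_itvoc ?lerDl// -lee_fin -integral_itv_pdf ?expR_ge0//.
rewrite -tailE tail_shift.
apply: (@le_trans _ _ (\int[mu]_(s in `]y, (y + 1)%R]) (pdf (s + h))%:E)%E).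
  apply: ge0_le_integral => //.
  - by move=> s _; rewrite lee_fin mulr_ge0 ?expR_ge0 ?normal_pdf_ge0.
  - exact: measurable_funTS (measurable_scaled_pdf _).
  - exact: measurable_funTS (measurable_shifted_pdf h).
  - move=> s; rewrite /= in_itv/= => /andP[_ sy].
    rewrite lee_fin std_normal_pdf_shift ler_wpM2r ?normal_pdf_ge0// ler_expR.
    by rewrite lerB// lerN2 ler_wpM2r.
apply: ge0_subset_integral => //.
- exact: measurable_funTS (measurable_shifted_pdf h).
- by move=> s _; rewrite lee_fin normal_pdf_ge0.
- by move=> s /=; rewrite !in_itv/= andbT => /andP[].
Qed.

Lemma tail_gt0 x : 0 < tail x.
Proof.
pose c := normal_peak 1 * expR (- (`|x| + 1) ^+ 2 / 2) : R.
have c0 : 0 < c by rewrite mulr_gt0 ?expR_gt0 ?normal_peak_gt0 ?oner_neq0.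
apply: (lt_le_trans c0); rewrite -lee_fin -tailE.
apply: (@le_trans _ _ (\int[mu]_(s in `]x, (x + 1)%R]) (cst c%:E) s)%E).
  rewrite integral_cst//= lebesgue_measure_itv/= lte_fin ltrDl ltr01.
  by rewrite -EFinB addrAC subrr add0r mule1.
apply: (@le_trans _ _ (\int[mu]_(s in `]x, (x + 1)%R]) (pdf s)%:E)%E).
  apply: ge0_le_integral => //.
  - by move=> s _; rewrite lee_fin ltW.
  - exact: measurable_funTS measurable_std_normal_pdf.
  - move=> s; rewrite /= in_itv/= => /andP[xs sx].
    rewrite lee_fin std_normal_pdfE ler_wpM2l ?normal_peak_ge0// ler_expR.
    rewrite ler_wpM2r ?invr_ge0// lerN2 -real_normK ?num_real//.
    rewrite lerXn2r ?nnegrE ?addr_ge0//.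
    have := ler_norm x; have := ler_norm (- x); rewrite normrN => h1 h2.
    by rewrite ler_norml; apply/andP; split; lra.
apply: ge0_subset_integral => //.
- exact: measurable_funTS measurable_std_normal_pdf.
- by move=> s _; rewrite lee_fin normal_pdf_ge0.
- by move=> s /=; rewrite !in_itv/= andbT => /andP[].
Qed.

Lemma tailD_le_exp y h : 0 <= h -> tail (y + h) <= expR (- (y * h)) * tail y.
Proof.
move=> h0; apply: (le_trans (tailD_le y h h0)).
by rewrite ler_wpM2r ?tail_ge0// ler_expR lerBlDr lerDl mulr_ge0 ?sqr_ge0// invr_ge0.
Qed.

Lemma tail_le_exp x : 0 <= x -> tail x <= expR (- (x ^+ 2 / 2)).
Proof.
move=> x0; have := tailD_le 0 x x0; rewrite add0r mul0r oppr0 add0r => h.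
by apply: (le_trans h); rewrite ler_piMr ?expR_ge0 ?tail_le1.
Qed.

(** The mass beyond y + 1 discarded by [tailD_ge] is at most exp(- y) times the tail at [y], by the
    upper shift bound with h = 1. *)
Lemma tail_ratio y h : 0 <= y -> 0 <= h ->
  (1 - expR (- y)) * tail y <= expR ((y + 1) * h + h ^+ 2 / 2) * tail (y + h).
Proof.
move=> y0 h0; have := tailD_ge y h h0.
set e := - ((y + 1) * h) - h ^+ 2 / 2.
have -> : (y + 1) * h + h ^+ 2 / 2 = - e by rewrite /e; ring.
move=> H; rewrite -(ler_pM2l (expR_gt0 e)) mulrA mulrA.
rewrite -expRD subrr expR0 mul1r; apply: le_trans H.
rewrite -mulrA ler_wpM2l ?expR_ge0//.
have := tailD_le_exp y 1 ler01; rewrite mulr1; lra.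
Qed.

Lemma gauss_opp (B : set R) : measurable B -> gauss (-%R @^-1` B) = gauss B.
Proof.
move=> mB.
have mB' : measurable ((-%R : R -> R) @^-1` B).
  by rewrite -[X in measurable X]setTI; exact: oppr_measurable.
have mf : measurable_fun setT (fun x : R => (\1_B x : R)%:E).
  by apply/measurable_EFinP; exact: measurable_indic.
have f0 x : (0 <= (\1_B x : R)%:E)%E by rewrite lee_fin.
have E := integral_std_normal_opp (fun x => (\1_B x : R)%:E) f0 mf.
apply: etrans (etrans E _).
  by apply/esym; apply: (etrans (integral_indic (normal_prob 0 1) measurableT mB')); rewrite setIT.
by apply: (etrans (integral_indic (normal_prob 0 1) measurableT mB)); rewrite setIT.
Qed.

Lemma abs_gtE (a : R) :
  [set x : R | a < `|x|] = `]a, +oo[%classic `|` -%R @^-1` `]a, +oo[%classic.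
Proof.
apply/seteqP; split=> x /=; rewrite !in_itv/= !andbT ltrNr.
  by rewrite ltr_normr => /orP[ax|ax]; [left|right; lra].
by case=> [ax|xa]; [rewrite ltr_normr ax|rewrite ltr_normr; apply/orP; right; lra].
Qed.

Lemma measurable_gtN (a : R) : measurable ((-%R : R -> R) @^-1` `]a, +oo[%classic).
Proof. by rewrite -[X in measurable X]setTI; exact: oppr_measurable. Qed.

Lemma measurable_abs_gt (a : R) : measurable [set x : R | a < `|x|].
Proof. by rewrite abs_gtE; apply: measurableU; [exact: measurable_itv|exact: measurable_gtN]. Qed.

Lemma gauss_abs_gt (a : R) : 0 <= a ->
  (gauss [set x : R | (a < `|x|)%R] <= (2 * expR (- (a ^+ 2 / 2)))%:E)%E.
Proof.
move=> a0; pose B : set R := `]a, +oo[%classic.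
have mB : measurable B by exact: measurable_itv.
have mB' := measurable_gtN a.
rewrite abs_gtE -/B.
have h : (gauss (B `|` -%R @^-1` B) <= gauss B + gauss (-%R @^-1` B))%E.
  exact: (measureU2 (normal_prob 0 1) mB mB').
apply: (le_trans h); rewrite gauss_opp// tailE -EFinD lee_fin.
by have := tail_le_exp a a0; lra.
Qed.

Lemma gauss_set1 (a : R) : gauss [set a] = 0%E.
Proof.
have /null_content_dominatesP := normal_prob_dominates (0:R) 1.
by apply => //; exact: lebesgue_measure_set1.
Qed.

End Tail.

(** * The event that a given coordinate is maximal *)

Section MaxEvent.
Context {R : realType} {d : nat}.
Variables (lam beta : 'I_d -> R) (g u : R).
Local Notation V := (vec R d).
Local Notation gauss := (@normal_prob R 0 1).
Local Notation X := (Xvec lam beta g).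

Definition max_event (j : 'I_d) : set ('I_d -> R) :=
  [set y | u < Ssum (X y) /\ X y j = Mmax (X y)].

(** This is [Zcond] as a function of the Gaussian vector, the form to which laws on [vec R d]
    apply. *)
Definition cond_prob_max (A : 'M[R]_d) (j : 'I_d) (n : 'I_d -> R) : R :=
  fine (gauss [set t | max_event j (matvec A (replace_at n j t))]).

Lemma measurable_Xvec i : measurable_fun setT (fun y : V => X y i).
Proof.
apply: measurable_funM => //; apply: measurableT_comp => //.
by apply: measurable_funM => //; exact: measurable_coord.
Qed.

Lemma measurable_Ssum : measurable_fun setT (fun y : V => Ssum (X y)).
Proof. by apply: measurable_sum => i; exact: measurable_Xvec. Qed.

Lemma measurable_Mmax : measurable_fun setT (fun y : V => Mmax (X y)).
Proof.
rewrite /Mmax; elim: (index_enum _) => [|i r IH].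
  have -> : (fun y : V => \big[Num.max/0]_(i <- [::]) X y i) = cst 0 by
    apply/funext => y; rewrite big_nil.
  exact: measurable_cst.
have -> : (fun y : V => \big[Num.max/0]_(i0 <- i :: r) X y i0) =
    ((fun y => X y i) \max (fun y => \big[Num.max/0]_(i0 <- r) X y i0)).
  by apply/funext => y; rewrite big_cons.
by apply: measurable_maxr => //; exact: measurable_Xvec.
Qed.

Lemma measurable_pred (h : V -> bool) : measurable_fun setT h ->
  measurable ([set y | h y] : set V).
Proof.
move=> mh; rewrite (_ : [set y | h y] = h @^-1` [set true]); last first.
  by apply/seteqP; split=> y /=; [move=> ->|move=> ->].
by rewrite -[X in measurable X]setTI; apply: mh.
Qed.

Lemma measurable_sum_event : measurable ([set y | u < Ssum (X y)] : set V).
Proof.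
apply: (measurable_pred (fun y => u < Ssum (X y))); apply: measurable_fun_ltr => //.
exact: measurable_Ssum.
Qed.

Lemma measurable_tie_event i j : measurable ([set y | X y i == X y j] : set V).
Proof.
apply: (measurable_pred (fun y => X y i == X y j)).
by apply: measurable_fun_eqr; exact: measurable_Xvec.
Qed.

Lemma measurable_max_event j : measurable (max_event j : set V).
Proof.
rewrite (_ : max_event j = [set y | u < Ssum (X y)] `&` [set y | X y j == Mmax (X y)]).
  apply: measurableI; first exact: measurable_sum_event.
  apply: (measurable_pred (fun y => X y j == Mmax (X y))).
  by apply: measurable_fun_eqr; [exact: measurable_Xvec|exact: measurable_Mmax].
by apply/seteqP; split=> y /= [h1 /eqP h2].
Qed.

Lemma measurable_preimage_matvec (A : 'M[R]_d) (B : set V) :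
  measurable B -> measurable ([set n | B (matvec A n)] : set V).
Proof.
move=> mB.
have mA : measurable_fun setT ((fun n => matvec A n) : V -> V).
  by apply: measurable_fun_vec => i; exact: measurable_matvec.
by rewrite -[X in measurable X]setTI; exact: mA.
Qed.

Lemma measurable_slice (B : set V) (j : 'I_d) (n : 'I_d -> R) :
  measurable B -> measurable [set t : R | B (replace_at n j t)].
Proof.
move=> mB.
have mr : measurable_fun setT ((fun t => replace_at n j t) : R -> V).
  exact: measurable_fun_replace_at.
by rewrite -[X in measurable X]setTI; exact: mr.
Qed.

Lemma integral_gauss_slice (B : set V) (j : 'I_d) (n : 'I_d -> R) : measurable B ->
  (\int[gauss]_t (\1_B (replace_at n j t) : R)%:E)%E
  = (fine (gauss [set t | B (replace_at n j t)]))%:E.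
Proof.
move=> mB; have mS := measurable_slice B j n mB.
rewrite -gauss_fine//.
by apply: (etrans (integral_indic (normal_prob 0 1) measurableT mS)); rewrite setIT.
Qed.

Lemma measurable_indic_vec (B : set V) : measurable B ->
  measurable_fun setT (fun n : V => (\1_B n : R)%:E).
Proof. by move=> mB; apply/measurable_EFinP; exact: measurable_indic. Qed.

Lemma measurable_cond_prob (B : set V) (j : 'I_d) : measurable B ->
  measurable_fun setT (fun n : V => fine (gauss [set t | B (replace_at n j t)])).
Proof.
move=> mB; apply/measurable_EFinP.
have h0 (n : V) : (0 <= (\1_B n : R)%:E)%E by rewrite lee_fin.
have := measurable_fun_resample j _ (measurable_indic_vec B mB) h0.
by congr measurable_fun; apply/funext => n; exact: integral_gauss_slice.
Qed.

Lemma measurable_cond_prob_max (A : 'M[R]_d) j :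
  measurable_fun setT (cond_prob_max A j : V -> R).
Proof.
exact: (measurable_cond_prob _ j (measurable_preimage_matvec A _ (measurable_max_event j))).
Qed.

Lemma cond_prob_max_ge0 A j n : 0 <= cond_prob_max A j n.
Proof. exact: fine_gauss_ge0. Qed.

Lemma measurable_max_slice A j n :
  measurable [set t : R | max_event j (matvec A (replace_at n j t))].
Proof.
exact: (measurable_slice _ j n (measurable_preimage_matvec A _ (measurable_max_event j))).
Qed.

Lemma cond_prob_max_le1 A j n : cond_prob_max A j n <= 1.
Proof. by apply: fine_gauss_le1; exact: measurable_max_slice. Qed.

Context {dT : measure_display} {T : measurableType dT} (P : probability T R).
Variable (N : T -> 'I_d -> R).
Hypothesis iN : iid_std_normal P N.

Lemma integral_indic_law (B : set V) : measurable B ->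
  (\int[P]_w (\1_B (N w) : R)%:E)%E = P [set w | B (N w)].
Proof.
move=> mB; have mS : measurable [set w | B (N w)].
  by rewrite -[X in measurable X]setTI; exact: iN.1.
by apply: (etrans (integral_indic P measurableT mS)); rewrite setIT.
Qed.

Lemma integral_cond_prob (B : set V) (j : 'I_d) : measurable B ->
  (\int[P]_w (fine (gauss [set t | B (replace_at (N w) j t)]))%:E)%E
  = P [set w | B (N w)].
Proof.
move=> mB; rewrite -integral_indic_law//.
have h0 (n : V) : (0 <= (\1_B n : R)%:E)%E by rewrite lee_fin.
apply/esym; apply: (etrans (integral_resample P N j _ iN (measurable_indic_vec B mB) h0)).
by apply: eq_integral => w _; exact: integral_gauss_slice.
Qed.

(** Averaging over the other coordinates restores the probability of the event under [A], and
    equality in law moves it to [A0]. With one [A0] for all [j], the means of the Z_j become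
    probabilities of events in a single model and can be added. *)
Lemma integral_cond_prob_max (A A0 : 'M[R]_d) j :
  A \in unitmx -> A *m A^T = A0 *m A0^T ->
  (\int[P]_w (cond_prob_max A j (N w))%:E =
   \int[P]_w (\1_(max_event j : set V) (matvec A0 (N w)) : R)%:E)%E.
Proof.
move=> uA AA0; have mG := measurable_max_event j.
have h0 (n : V) : (0 <= (\1_(max_event j : set V) n : R)%:E)%E by rewrite lee_fin.
rewrite -(eq_law_factor P A A0 N _ uA AA0 iN (measurable_indic_vec _ mG) h0).
have mB := measurable_preimage_matvec A _ mG.
by rewrite (integral_cond_prob _ j mB) -integral_indic_law.
Qed.

Hypothesis lam0 : forall i, 0 < lam i.
Hypothesis beta0 : forall i, 0 < beta i.
Hypothesis g0 : 0 < g.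

Lemma Xvec_gt0 y i : 0 < X y i.
Proof. by rewrite /Xvec mulr_gt0 ?expR_gt0. Qed.

Lemma ln_Xvec y i : ln (X y i) = ln (lam i) + beta i * g * y i.
Proof. by rewrite /Xvec lnM ?posrE ?expR_gt0// expRK. Qed.

(** Otherwise rows [i] and [j] of an invertible matrix would satisfy a nontrivial linear
    relation. *)
Lemma unit_rows_neq (A : 'M[R]_d) i j : A \in unitmx -> i != j ->
  exists k, beta i * g * A i k - beta j * g * A j k != 0.
Proof.
move=> uA ij; apply/existsP; rewrite -negb_forall; apply/negP => /forallP H.
pose v : 'rV[R]_d := \row_k (beta i * g * (k == i)%:R - beta j * g * (k == j)%:R).
have vA : v *m A = 0.
  apply/matrixP => a k; rewrite !mxE.
  under eq_bigr do rewrite mxE mulrBl -!mulrA.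
  rewrite sumrB -!mulr_sumr (sum_delta i (A^~ k)) (sum_delta j (A^~ k)).
  by have /eqP := H k; rewrite !mulrA.
have : v = 0 by rewrite -[v](mulmxK uA) vA mul0mx.
move/matrixP/(_ ord0 i); rewrite !mxE eqxx (negbTE ij) mulr1 mulr0 subr0 => /eqP.
by rewrite gt_eqF// mulr_gt0.
Qed.

(** After taking logarithms a tie is an affine equation in one well-chosen N_k with nonzero slope
    [c]; given the other coordinates, its solutions lie in a single point, which has Gaussian
    measure zero. *)
Lemma tie_null (A : 'M[R]_d) i j : A \in unitmx -> i != j ->
  P [set w | X (matvec A (N w)) i == X (matvec A (N w)) j] = 0%E.
Proof.
move=> uA ij; have [k ck] := unit_rows_neq A i j uA ij.
have mB := measurable_preimage_matvec A _ (measurable_tie_event i j).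
rewrite -(integral_cond_prob _ k mB); apply: integral0_eq => w _.
set S := [set t | _]; suff -> : gauss S = 0%E by [].
have mS : measurable S := measurable_slice _ k (N w) mB.
pose n0 := replace_at (N w) k 0.
have mv l t : matvec A (replace_at (N w) k t) l = matvec A n0 l + A l k * t.
  rewrite /matvec (bigD1 k)//= [in RHS](bigD1 k)//= /n0 /replace_at eqxx mulr0 add0r addrC.
  by congr (_ + _); apply: eq_bigr => m /negbTE ->.
pose c := beta i * g * A i k - beta j * g * A j k.
pose a := (ln (lam j) + beta j * g * matvec A n0 j -
           (ln (lam i) + beta i * g * matvec A n0 i)) / c.
apply/eqP; rewrite eq_le gauss_ge0 andbT -(gauss_set1 a).
have := @le_measure _ _ _ (normal_prob 0 1) S [set a]; rewrite !inE; apply => //.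
move=> t; rewrite /S /= => /eqP/(congr1 (@ln R)); rewrite !ln_Xvec (mv i t) (mv j t) => E.
rewrite /a; apply: (mulIf ck); rewrite -/c divfK// /c.
by lra.
Qed.

(** Off the null set of ties exactly one index attains the maximum, so no outcome is counted
    twice. *)
Lemma sum_max_event (A : 'M[R]_d) (i0 : 'I_d) : A \in unitmx ->
  (\sum_j \int[P]_w (\1_(max_event j : set V) (matvec A (N w)) : R)%:E
   = P [set w | (u < Ssum (X (matvec A (N w))))%R])%E.
Proof.
move=> uA.
have mN : measurable_fun setT ((fun w => matvec A (N w)) : T -> V).
  exact: (measurable_fun_matvec _ _ _ _ iN.1).
have mi (B : set V) : measurable B ->
    measurable_fun setT (fun w => (\1_B (matvec A (N w)) : R)%:E).
  by move=> mB; exact: (measurableT_comp (measurable_indic_vec B mB) mN).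
rewrite -ge0_integral_sum//; [|by move=> j; exact: mi (measurable_max_event j)].
have mS := measurable_preimage_matvec A _ measurable_sum_event.
rewrite -(integral_indic_law _ mS).
apply: ae_eq_integral => //.
- by apply: emeasurable_sum => j; exact: mi (measurable_max_event j).
- exact: (mi _ measurable_sum_event).
have notie : \forall w \ae P, forall i j, i != j ->
    X (matvec A (N w)) i != X (matvec A (N w)) j.
  apply: filter_forall => i; apply: filter_forall => j.
  case: (eqVneq i j) => [->|ij]; first by apply: filterE => w; rewrite eqxx.
  exists [set w | X (matvec A (N w)) i == X (matvec A (N w)) j]; split.
  - have mB := measurable_preimage_matvec A _ (measurable_tie_event i j).
    by rewrite -[X in measurable X]setTI; exact: (iN.1 _ _ mB).
  - exact: tie_null.
  - by move=> w /= /not_implyP[_ /negP]; rewrite negbK.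
apply: filterS notie => w nt _; rewrite sumEFin; congr _%:E.
set y := matvec A (N w) in nt *.
have [Su|Su] := boolP (u < Ssum (X y)); last first.
  have nS : ~ (u < Ssum (X y)) by exact/negP.
  rewrite big1; first by rewrite indicE memNset//; exact: nS.
  by move=> j _; rewrite indicE memNset// => -[/nS].
pose j0 := [arg max_(i > i0) X y i]%O.
have Mj0 : Mmax (X y) = X y j0.
  (* The default value 0 in [Mmax] lies below every X_i, which is positive. *)
  by rewrite /Mmax /j0; apply: bigmax_eq_arg => // i _; rewrite ltW// Xvec_gt0.
rewrite (bigD1 j0)//= big1 ?addr0 => [|j jj0].
  by rewrite !indicE !mem_set.
rewrite indicE memNset//= => -[_]; rewrite Mj0 => /eqP.
by apply/negP; exact: nt.
Qed.

End MaxEvent.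

(** * The estimator *)

Section RandomIndex.
Context {R : realType} {d : nat}.
Context {dT : measure_display} {T : measurableType dT} (P : probability T R).
Local Notation V := (vec R d).
Local Notation gauss := (@normal_prob R 0 1).
Variables (N : 'I_d -> T -> R) (I : T -> 'I_d).
Hypothesis stdN : forall i, std_normal_rv P (N i).
Hypothesis indepN : mutually_indep P N I.
Hypothesis mI : forall i, measurable (I @^-1` [set i]).

Lemma indep_rect (b : 'I_d -> set R) (C : set 'I_d) : (forall i, measurable (b i)) ->
  P ([set w | rect b (Nvec N w)] `&` I @^-1` C)
  = ((\prod_i fine (gauss (b i))) * fine (P (I @^-1` C)))%:E.
Proof.
move=> mb; rewrite (_ : [set w | _] = \bigcap_i (N i @^-1` b i)).
  rewrite indepN//; congr (_ * _)%:E; apply: eq_bigr => i _.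
  by rewrite (stdN i).2.
by apply/seteqP; split=> w /=; [move=> h i _; exact: h|move=> h i; exact: h].
Qed.

Lemma iid_std_normal_Nvec : iid_std_normal P (Nvec N).
Proof.
split; first by apply: measurable_fun_vec => i; exact: (stdN i).1.
move=> b mb; have := indep_rect b setT mb.
by rewrite preimage_setT setIT probability_setT/= mulr1.
Qed.

(** [P] restricted to the event I = i and [P] scaled by the probability of that event agree on
    rectangles by the product rule, so they give the same integrals of functions of N. *)
Lemma integral_index_mul (h : V -> R) (i : 'I_d) :
  measurable_fun setT h -> (forall n, 0 <= h n) ->
  (\int[P]_w ((I w == i)%:R * h (Nvec N w))%:E
   = P (I @^-1` [set i]) * \int[P]_w (h (Nvec N w))%:E)%E.
Proof.
move=> mh h0; pose D := I @^-1` [set i]; have mD : measurable D by exact: mI.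
pose h' (n : V) := (h n)%:E.
have mh' : measurable_fun setT h' by apply/measurable_EFinP.
have h'0 n : (0 <= h' n)%E by rewrite lee_fin.
have mN := iid_std_normal_Nvec.1.
have mhN : measurable_fun setT (fun w => h' (Nvec N w)).
  exact: (measurableT_comp mh' mN).
pose m1 := [the {measure set T -> \bar R} of mrestr P mD].
pose p : {nonneg R} := NngNum (fine_ge0 (measure_ge0 P D)).
pose m2 := [the {measure set T -> \bar R} of mscale p P].
transitivity (\int[P]_(w in D) h' (Nvec N w))%E.
  rewrite [RHS]integral_mkcond; apply: eq_integral => w _; rewrite /patch /h'.
  case: ifPn => [|]; first by rewrite inE => ->; rewrite eqxx mul1r.
  by rewrite notin_setE => /eqP/negbTE ->; rewrite mul0r.
transitivity (\int[m1]_(w in D) h' (Nvec N w))%E.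
  by apply: eq_measure_integral => B mB BD; rewrite /m1/= /mrestr setIidl.
transitivity (\int[m1]_w h' (Nvec N w))%E.
  rewrite -(setvU D) setUC ge0_integral_setU//.
  - rewrite [X in (_ + X)%E]null_set_integral ?adde0//.
    + exact: measurableC.
    + exact: measurable_funTS.
    + by rewrite /m1/= /mrestr setICl measure0.
  - exact: measurableC.
  - exact: measurable_funTS.
  - by rewrite disj_set2E setICr.
transitivity (\int[m2]_w h' (Nvec N w))%E.
  apply: (eq_law_integral _ _ _ _ _ _ _ _ h' mN mN) => //.
    move=> b mb; have := indep_rect b [set i] mb; rewrite /m1/= /mrestr => ->.
    by rewrite /m2/= /mscale/= (iid_std_normal_Nvec.2 b mb) -EFinM mulrC.
  rewrite /m1/= /mrestr setTI.
  exact: (le_lt_trans (probability_le1 P mD) (ltry _)).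
rewrite /m2 ge0_integral_mscale//=; congr (_ * _)%E.
by rewrite fineK// fin_num_measure.
Qed.

Lemma integral_cst_prob (c : R) : (\int[P]_w c%:E = c%:E)%E.
Proof. by rewrite integral_cst//= probability_setT mule1. Qed.

Lemma measurable_index_eq i : measurable_fun setT (fun w => (I w == i)%:R : R).
Proof.
have -> : (fun w => (I w == i)%:R) = \1_(I @^-1` [set i]) :> (T -> R).
  apply/funext => w; rewrite indicE; congr (nat_of_bool _)%:R.
  by apply/idP/idP; rewrite ?inE /= => /eqP.
exact: measurable_indic.
Qed.

Lemma integral_random_index (h : 'I_d -> V -> R) :
  (forall i, measurable_fun setT (h i)) -> (forall i n, 0 <= h i n) ->
  (\int[P]_w (h (I w) (Nvec N w))%:E
   = \sum_i P (I @^-1` [set i]) * \int[P]_w (h i (Nvec N w))%:E)%E.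
Proof.
move=> mh h0; have mN := iid_std_normal_Nvec.1.
transitivity (\int[P]_w \sum_i ((I w == i)%:R * h i (Nvec N w))%:E)%E.
  by apply: eq_integral => w _; rewrite sumEFin (sum_deltaC (I w) (h^~ (Nvec N w))).
rewrite ge0_integral_sum//.
- by apply: eq_bigr => i _; exact: integral_index_mul.
- move=> i; apply/measurable_EFinP; apply: measurable_funM.
    exact: measurable_index_eq.
  exact: (measurableT_comp (mh i) mN).
- by move=> i w _; rewrite lee_fin mulr_ge0.
Qed.

End RandomIndex.

(** * Moments of the estimator *)

Section Estimator.
Context {R : realType} {d : nat}.
Context {dT : measure_display} {T : measurableType dT} (P : probability T R).
Variables (lam beta : 'I_d -> R) (gam : R -> R) (A : 'I_d -> R -> 'M[R]_d).
Variables (N : 'I_d -> T -> R) (I : R -> T -> 'I_d) (u : R).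
Hypothesis u0 : 0 < u.
Hypothesis lam0 : forall i, 0 < lam i.
Hypothesis beta0 : forall i, 0 < beta i.
Hypothesis gam0 : 0 < gam u.
Hypothesis uA : forall j, A j u \in unitmx.
Hypothesis AA : forall i j, A i u *m (A i u)^T = A j u *m (A j u)^T.
Hypothesis Aj : forall j k, A j u j k = (k == j)%:R.
Hypothesis stdN : forall i, std_normal_rv P (N i).
Hypothesis indepN : mutually_indep P N (I u).
Hypothesis mI : forall i, measurable (I u @^-1` [set i]).
Local Notation p i := (p_tail P lam beta gam A N i u).
Hypothesis lawI : forall i, P (I u @^-1` [set i]) = (p i / \sum_(k < d) p k)%:E.

Local Notation Z i := (Zcond lam beta gam A N i u).

(** The level [x] is separate from [u] because levels such as u / d and 2 u are compared at the same
    scale [gam u]. *)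
Definition threshold (i : 'I_d) (x : R) : R := ln (x / lam i) / (beta i * gam u).

Lemma threshold_lt (i : 'I_d) (x t : R) : 0 < x ->
  (x < lam i * expR (beta i * gam u * t)) = (threshold i x < t).
Proof.
move=> x0; transitivity (x / lam i < expR (beta i * gam u * t)).
  by rewrite ltr_pdivrMr// mulrC.
rewrite -ltr_ln ?posrE ?expR_gt0 ?divr_gt0// expRK.
by rewrite /threshold ltr_pdivrMr ?mulr_gt0// (mulrC t).
Qed.

Lemma matvec_unit_row i n : matvec (A i u) n i = n i.
Proof. by rewrite /matvec; under eq_bigr do rewrite Aj; rewrite sum_delta. Qed.

Lemma p_tailE i : p i = tail (threshold i u).
Proof.
rewrite /p_tail /tail -(stdN i).2//; congr (fine (P _)).
apply/seteqP; split=> w; rewrite /Xof /Xvec /= matvec_unit_row in_itv/= andbT;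
  by rewrite threshold_lt.
Qed.

Lemma p_tail_gt0 i : 0 < p i.
Proof. by rewrite p_tailE tail_gt0. Qed.

Lemma Zcond_Nvec i w : Z i w = cond_prob_max lam beta (gam u) u (A i u) i (Nvec N w).
Proof. by []. Qed.

Definition zmoment (m : nat) (i : 'I_d) : R := fine (\int[P]_w (Z i w ^+ m)%:E)%E.

Lemma measurable_zpow m i : measurable_fun setT (fun n : vec R d =>
  cond_prob_max lam beta (gam u) u (A i u) i n ^+ m).
Proof. by apply: measurable_funX; exact: measurable_cond_prob_max. Qed.

Lemma measurable_Zpow m i : measurable_fun setT (fun w => (Z i w ^+ m)%:E).
Proof.
apply/measurable_EFinP.
exact: (measurableT_comp (measurable_zpow m i) (iid_std_normal_Nvec P N (I u) stdN indepN).1).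
Qed.

Lemma Zpow_itv m i w : 0 <= Z i w ^+ m <= 1.
Proof.
by rewrite exprn_ge0 ?exprn_ile1// Zcond_Nvec ?cond_prob_max_ge0 ?cond_prob_max_le1.
Qed.

Lemma zmomentE m i : (\int[P]_w (Z i w ^+ m)%:E = (zmoment m i)%:E)%E.
Proof.
rewrite /zmoment fineK// ge0_fin_numE; last first.
  by apply: integral_ge0 => w _; rewrite lee_fin; case/andP: (Zpow_itv m i w).
apply: (@le_lt_trans _ _ (\int[P]_w (cst 1%E) w)%E).
  apply: ge0_le_integral => //.
  - by move=> w _; rewrite lee_fin; case/andP: (Zpow_itv m i w).
  - exact: measurable_Zpow.
  - by move=> w _; rewrite lee_fin; case/andP: (Zpow_itv m i w).
by rewrite integral_cst//= mul1e (le_lt_trans (probability_le1 P measurableT))// ltry.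
Qed.

Lemma sum_zmoment j0 : \sum_i zmoment 1 i = alpha P lam beta gam A N j0 u.
Proof.
have iN := iid_std_normal_Nvec P N (I u) stdN indepN.
apply: EFin_inj; rewrite -sumEFin.
transitivity (\sum_j \int[P]_w (\1_(max_event lam beta (gam u) u j : set (vec R d))
    (matvec (A j0 u) (Nvec N w)) : R)%:E)%E.
  apply: eq_bigr => j _; rewrite -zmomentE.
  rewrite -(integral_cond_prob_max lam beta (gam u) u P _ iN _ _ j (uA j) (AA j j0)).
  by apply: eq_integral => w _; rewrite expr1.
rewrite (sum_max_event lam beta (gam u) u P _ iN lam0 beta0 gam0 _ j0 (uA j0)).
rewrite /alpha fineK// fin_num_measure//.
have mS := measurable_preimage_matvec (A j0 u) _ (measurable_sum_event lam beta (gam u) u).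
by rewrite -[X in measurable X]setTI; exact: (iN.1 _ _ mS).
Qed.

Lemma ZmakE w : Zmak P lam beta gam A N I u w =
  (\sum_(k < d) p k) * (Z (I u w) w / p (I u w)).
Proof. by rewrite /Zmak (sum_deltaC (I u w) (fun i => Z i w / p i)). Qed.

Lemma sum_p_gt0 (j0 : 'I_d) : 0 < \sum_(k < d) p k.
Proof.
by rewrite (bigD1 j0)//= ltr_pwDl ?p_tail_gt0// sumr_ge0// => i _; rewrite ltW ?p_tail_gt0.
Qed.

(** One power of the weight cancels against the law of the index. The case m = 0 is unbiasedness and
    m = 1 the second moment. *)
Lemma integral_Zmak_pow (j0 : 'I_d) m :
  (\int[P]_w (Zmak P lam beta gam A N I u w ^+ m.+1)%:E
   = ((\sum_(k < d) p k) ^+ m * \sum_i zmoment m.+1 i / p i ^+ m)%:E)%E.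
Proof.
have iN := iid_std_normal_Nvec P N (I u) stdN indepN.
have sp := sum_p_gt0 j0.
pose c i := ((\sum_(k < d) p k) / p i) ^+ m.+1.
have c0 i : 0 <= c i by rewrite exprn_ge0// divr_ge0 ?ltW ?p_tail_gt0.
pose h i (n : vec R d) := c i * cond_prob_max lam beta (gam u) u (A i u) i n ^+ m.+1.
transitivity (\int[P]_w (h (I u w) (Nvec N w))%:E)%E.
  apply: eq_integral => w _; rewrite ZmakE /h -Zcond_Nvec /c -exprMn.
  by congr (_ ^+ _)%:E; rewrite mulrA mulrAC.
rewrite (integral_random_index P N (I u) stdN indepN mI h); first last.
- by move=> i n; rewrite mulr_ge0// exprn_ge0// cond_prob_max_ge0.
- by move=> i; apply: measurable_funM => //; exact: measurable_zpow.
rewrite mulr_sumr -sumEFin; apply: eq_bigr => i _; rewrite lawI /h.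
under eq_integral do rewrite EFinM.
rewrite ge0_integralZl//; last 3 first.
- exact: (measurable_Zpow m.+1 i).
- by move=> w _; rewrite lee_fin; case/andP: (Zpow_itv m.+1 i w).
- by rewrite lee_fin.
rewrite (zmomentE m.+1 i) -!EFinM; congr _%:E.
rewrite /c !exprS expr_div_n; field.
by rewrite !gt_eqF ?p_tail_gt0// exprn_gt0// p_tail_gt0.
Qed.

Lemma integral_Zmak j0 :
  (\int[P]_w (Zmak P lam beta gam A N I u w)%:E = (alpha P lam beta gam A N j0 u)%:E)%E.
Proof.
have := integral_Zmak_pow j0 0; under eq_integral do rewrite expr1.
move=> ->; rewrite expr0 mul1r -(sum_zmoment j0); congr _%:E.
by apply: eq_bigr => i _; rewrite expr0 divr1.
Qed.

Lemma integral_Zmak_sqr (j0 : 'I_d) :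
  fine (\int[P]_w (Zmak P lam beta gam A N I u w ^+ 2)%:E)%E
  = (\sum_(k < d) p k) * \sum_i zmoment 2 i / p i.
Proof. by rewrite (integral_Zmak_pow j0 1)/= expr1. Qed.

Lemma Zcond_ge0 i w : 0 <= Z i w.
Proof. exact: fine_gauss_ge0. Qed.

Lemma measurable_Zmak : measurable_fun setT (Zmak P lam beta gam A N I u).
Proof.
apply: measurable_funM => //; apply: measurable_sum => i.
apply: measurable_funM; first exact: measurable_index_eq.
apply: measurable_funM => //; apply/measurable_EFinP.
by have := measurable_Zpow 1 i; under eq_fun do rewrite expr1.
Qed.

Lemma Zmak_ge0 w : 0 <= Zmak P lam beta gam A N I u w.
Proof.
rewrite ZmakE mulr_ge0//; first by rewrite ltW// (sum_p_gt0 (I u w)).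
by apply: divr_ge0; [exact: Zcond_ge0|rewrite ltW ?p_tail_gt0].
Qed.

Lemma alpha_ge0 j0 : 0 <= alpha P lam beta gam A N j0 u.
Proof. exact/fine_ge0/measure_ge0. Qed.

(* Jensen: integrate 2 a Z <= Z ^ 2 + a ^ 2 with a = E Z. *)
Lemma alpha_sqr_le (j0 : 'I_d) :
  alpha P lam beta gam A N j0 u ^+ 2
  <= fine (\int[P]_w (Zmak P lam beta gam A N I u w ^+ 2)%:E)%E.
Proof.
set a := alpha _ _ _ _ _ _ _ _; have a0 : 0 <= a := alpha_ge0 j0.
set Y := Zmak P lam beta gam A N I u.
have mY := measurable_Zmak; have mY2 := measurable_funX 2 mY.
have E2 : (\int[P]_w (Y w ^+ 2)%:E = (fine (\int[P]_w (Y w ^+ 2)%:E))%:E)%E.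
  by rewrite /Y (integral_Zmak_pow j0 1).
have : (\int[P]_w ((2 * a)%:E * (Y w)%:E) <= \int[P]_w ((Y w ^+ 2)%:E + (a ^+ 2)%:E))%E.
  apply: ge0_le_integral => //.
  - move=> w _; rewrite -EFinM lee_fin; apply: mulr_ge0; first exact: mulr_ge0.
    exact: Zmak_ge0.
  - by apply/measurable_EFinP; exact: measurable_funM.
  - by apply/measurable_EFinP; exact: measurable_funD.
  - move=> w _; rewrite -EFinM -EFinD lee_fin.
    by have := sqr_ge0 (Y w - a); rewrite sqrrB; lra.
rewrite ge0_integralZl//; last 3 first.
- exact/measurable_EFinP.
- by move=> w _; rewrite lee_fin Zmak_ge0.
- by rewrite lee_fin mulr_ge0.
rewrite /Y (integral_Zmak j0) -/Y -/a.
rewrite ge0_integralD//; last 3 first.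
- by move=> w _; rewrite lee_fin sqr_ge0.
- exact/measurable_EFinP.
- by move=> w _; rewrite lee_fin sqr_ge0.
rewrite integral_cst_prob E2 -EFinM -EFinD lee_fin => h.
by rewrite expr2 in h *; lra.
Qed.

Lemma sum_le_max (y : 'I_d -> R) j : (forall i, 0 <= y i) -> y j = Mmax y ->
  Ssum y <= d%:R * y j.
Proof.
move=> y0 yj; rewrite /Ssum -[X in X%:R]card_ord -sum1_card natr_sum mulr_suml.
by apply: ler_sum => i _; rewrite mul1r yj; exact: le_bigmax.
Qed.

Lemma Xof_replace_at i (n : 'I_d -> R) t :
  Xvec lam beta (gam u) (matvec (A i u) (replace_at n i t)) i
  = lam i * expR (beta i * gam u * t).
Proof. by rewrite /Xvec matvec_unit_row /replace_at eqxx. Qed.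

Lemma Zcond_le i w (B : R) : 0 < B ->
  (forall t, max_event lam beta (gam u) u i (matvec (A i u) (replace_at (Nvec N w) i t)) ->
     B < lam i * expR (beta i * gam u * t)) ->
  Z i w <= tail (threshold i B).
Proof.
move=> B0 H; apply: fine_gauss_le => //; first exact: measurable_max_slice.
by move=> t /H; rewrite threshold_lt// /= in_itv/= andbT.
Qed.

(** A maximal summand is at least S / d. *)
Lemma Zcond_le_tail i w : Z i w <= tail (threshold i (u / d%:R)).
Proof.
have d0 : 0 < d%:R :> R by rewrite ltr0n (leq_ltn_trans _ (ltn_ord i)).
apply: Zcond_le; first by rewrite divr_gt0.
move=> t [uS xm]; rewrite ltr_pdivrMr// mulrC -(Xof_replace_at i (Nvec N w)).
apply: (lt_le_trans uS); apply: sum_le_max => // k.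
by rewrite ltW// Xvec_gt0.
Qed.

(** When u < X_i <= B and the others are at most [u], coordinate [i] is maximal and alone makes the
    sum exceed [u]. The cap [B] keeps X_i in the range where the others are controlled. *)
Lemma Zcond_ge i w (B : R) : u <= B ->
  (forall t k, u < lam i * expR (beta i * gam u * t) <= B -> k != i ->
     Xvec lam beta (gam u) (matvec (A i u) (replace_at (Nvec N w) i t)) k <= u) ->
  tail (threshold i u) - tail (threshold i B) <= Z i w.
Proof.
move=> uB H; have B0 : 0 < B by exact: lt_le_trans uB.
have thr : threshold i u <= threshold i B.
  rewrite /threshold ler_pM2r ?invr_gt0 ?mulr_gt0//.
  by rewrite ler_ln ?posrE ?divr_gt0// ler_pM2r ?invr_gt0.
rewrite -gauss_itvoc//; apply: fine_gauss_le => //; first exact: measurable_max_slice.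
move=> t /=; rewrite in_itv/= => /andP[ut tB].
have ux : u < lam i * expR (beta i * gam u * t) by rewrite threshold_lt.
have xB : lam i * expR (beta i * gam u * t) <= B.
  by rewrite leNgt threshold_lt// -leNgt.
rewrite /= /Xof; set y := matvec _ _; have X0 k : 0 < Xvec lam beta (gam u) y k by exact: Xvec_gt0.
have xi : Xvec lam beta (gam u) y i = lam i * expR (beta i * gam u * t).
  exact: Xof_replace_at.
have Hk k : Xvec lam beta (gam u) y k <= Xvec lam beta (gam u) y i.
  case: (eqVneq k i) => [->//|ki]; rewrite xi; apply: le_trans (ltW ux).
  by apply: H => //; rewrite ux xB.
split; last first.
  apply/eqP; rewrite eq_le le_bigmax/=; by apply: bigmax_le => [|k _]; [exact: ltW|exact: Hk].
apply: (lt_le_trans ux); rewrite /Ssum (bigD1 i)//= xi lerDl.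
by apply: sumr_ge0 => k _; exact: ltW.
Qed.

Definition large_coord (a : R) (k : 'I_d) : set T := [set w | a < `|N k w|].

Lemma measurable_large_coord a k : measurable (large_coord a k).
Proof.
rewrite -[X in measurable X]setTI; apply: ((stdN k).1 _ [set x | a < `|x|]) => //.
exact: measurable_abs_gt.
Qed.

Lemma sum_large_coord a : 0 <= a ->
  (\sum_k P (large_coord a k) <= (d%:R * (2 * expR (- (a ^+ 2 / 2))))%:E)%E.
Proof.
move=> a0; rewrite -[X in X%:R]card_ord -sum1_card natr_sum mulr_suml -sumEFin.
apply: lee_sum => k _; rewrite mul1r.
have mS := measurable_abs_gt a.
apply: le_trans (gauss_abs_gt a a0).
by rewrite -((stdN k).2 _ mS).
Qed.

Lemma integral_sum_large (c a : R) : 0 <= c -> 0 <= a ->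
  (\int[P]_w (c * \sum_k (\1_(large_coord a k) w : R))%:E
   <= (c * (d%:R * (2 * expR (- (a ^+ 2 / 2)))))%:E)%E.
Proof.
move=> c0 a0.
have mi k : measurable_fun setT (fun w => (\1_(large_coord a k) w : R)%:E).
  by apply/measurable_EFinP/measurable_indic; exact: measurable_large_coord.
under eq_integral do rewrite EFinM -sumEFin.
rewrite ge0_integralZl//; last 2 first.
- by apply: emeasurable_sum => k; exact: mi.
- by move=> w _; apply: sume_ge0 => k _; rewrite lee_fin.
rewrite ge0_integral_sum// EFinM lee_wpmul2l ?lee_fin//.
apply: le_trans (sum_large_coord a a0); apply: lee_sum => k _.
by rewrite integral_indic ?setIT//; exact: measurable_large_coord.
Qed.

Lemma large_coord_cases a w : (forall k, `|N k w| <= a) \/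
  1 <= \sum_k (\1_(large_coord a k) w : R).
Proof.
have [/forallP H|] := boolP [forall k, `|N k w| <= a]; first by left.
rewrite negb_forall => /existsP[k]; rewrite -ltNge => ak; right.
rewrite (bigD1 k)//= indicE mem_set// lerDl.
by apply: sumr_ge0.
Qed.

Lemma measurable_sum_large (c a : R) :
  measurable_fun setT (fun w => c * \sum_k (\1_(large_coord a k) w : R)).
Proof.
apply: measurable_funM => //; apply: measurable_sum => k.
by apply: measurable_indic; exact: measurable_large_coord.
Qed.

Lemma sum_large_ge0 a w : 0 <= \sum_k (\1_(large_coord a k) w : R).
Proof. by apply: sumr_ge0. Qed.

(** Pointwise, Z_i ^ 2 is at most B ^ 2 plus q ^ 2 times the number of large coordinates;
    integrating that count amounts to a union bound. *)
Lemma zmoment2_le i (a B q : R) : 0 <= a -> 0 <= B -> (forall w, Z i w <= q) ->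
  (forall w, (forall k, `|N k w| <= a) -> Z i w <= B) ->
  zmoment 2 i <= B ^+ 2 + q ^+ 2 * (d%:R * (2 * expR (- (a ^+ 2 / 2)))).
Proof.
move=> a0 B0 Zq ZB; rewrite -lee_fin -zmomentE.
have Z0 w : 0 <= Z i w by rewrite Zcond_Nvec cond_prob_max_ge0.
apply: (@le_trans _ _ (\int[P]_w ((B ^+ 2)%:E +
    (q ^+ 2 * \sum_k (\1_(large_coord a k) w : R))%:E))%E).
  apply: ge0_le_integral => //.
  - by move=> w _; rewrite lee_fin sqr_ge0.
  - exact: measurable_Zpow.
  - by apply/measurable_EFinP/measurable_funD => //; exact: measurable_sum_large.
  - move=> w _; rewrite -EFinD lee_fin.
    have [/ZB zb|h] := large_coord_cases a w.
      apply: (@le_trans _ _ (B ^+ 2)); first by rewrite lerXn2r ?nnegrE.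
      by rewrite lerDl mulr_ge0 ?sqr_ge0 ?sum_large_ge0.
    apply: (@le_trans _ _ (q ^+ 2)).
      by have q0 := le_trans (Z0 w) (Zq w); rewrite lerXn2r ?nnegrE.
    apply: (@le_trans _ _ (q ^+ 2 * \sum_k (\1_(large_coord a k) w : R))).
      by rewrite ler_peMr ?sqr_ge0.
    by rewrite lerDr sqr_ge0.
rewrite ge0_integralD//; last 3 first.
- by move=> w _; rewrite lee_fin sqr_ge0.
- by move=> w _; rewrite lee_fin mulr_ge0 ?sqr_ge0 ?sum_large_ge0.
- by apply/measurable_EFinP; exact: measurable_sum_large.
rewrite integral_cst_prob EFinD leeD2l//.
by apply: integral_sum_large => //; exact: sqr_ge0.
Qed.

(** Integrates the pointwise bound of [b] by Z_i plus [b] times the number of large coordinates. *)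
Lemma zmoment1_ge i (a b : R) : 0 <= a -> 0 <= b ->
  (forall w, (forall k, `|N k w| <= a) -> b <= Z i w) ->
  b * (1 - d%:R * (2 * expR (- (a ^+ 2 / 2)))) <= zmoment 1 i.
Proof.
move=> a0 b0 bZ; rewrite mulrBr mulr1 lerBlDr -lee_fin EFinD -zmomentE.
have Z0 w : 0 <= Z i w by rewrite Zcond_Nvec cond_prob_max_ge0.
apply: le_trans (leeD2l _ (integral_sum_large b a b0 a0)).
rewrite -ge0_integralD//; last 4 first.
- by move=> w _; rewrite lee_fin expr1.
- exact: measurable_Zpow.
- by move=> w _; rewrite lee_fin mulr_ge0 ?sum_large_ge0.
- by apply/measurable_EFinP; exact: measurable_sum_large.
apply: (@le_trans _ _ (\int[P]_w (cst b%:E w))%E).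
  by rewrite integral_cst_prob.
apply: ge0_le_integral => //.
- apply: emeasurable_funD; first exact: measurable_Zpow.
  by apply/measurable_EFinP; exact: measurable_sum_large.
- move=> w _; rewrite -EFinD lee_fin expr1.
  have [/bZ zb|h] := large_coord_cases a w.
    by rewrite -[leLHS]addr0 lerD ?mulr_ge0 ?sum_large_ge0.
  by rewrite -[leLHS]add0r lerD// ler_peMr.
Qed.

End Estimator.

(** * Tail asymptotics *)

Section TailAsymptotics.
Context {R : realType}.

Lemma ln_near (K : R) : \forall u \near +oo, K <= ln u.
Proof.
have : \forall u \near +oo, expR K <= u by apply: nbhs_pinfty_ge; exact: num_real.
apply: filterS => u Ku; rewrite -[K]expRK ler_ln ?posrE ?expR_gt0//.
exact: lt_le_trans (expR_gt0 K) Ku.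
Qed.

Lemma gt_near (K : R) : \forall u \near +oo, K < u.
Proof. by apply: nbhs_pinfty_gt; exact: num_real. Qed.

(** The slack is shared between the two error sources of [tail_ratio]: (1 + e) (1 - exp(- y)) >= 1 +
    2 e / 3 leaves room for the factor 1 + e / 3. *)
Lemma tail_ratio_le (e y h : R) : 0 < e -> 0 <= y -> 0 <= h ->
  (y + 1) * h + h ^+ 2 / 2 <= ln (1 + e / 3) -> expR (- y) <= e / (3 * (1 + e)) ->
  tail y <= (1 + e) * tail (y + h).
Proof.
move=> e0 y0 h0 H1 H2; have H := tail_ratio y h y0 h0.
have e3 : 0 < 1 + e / 3 by lra.
have e1 : 0 < 1 + e by lra.
have H1' : expR ((y + 1) * h + h ^+ 2 / 2) <= 1 + e / 3.
  by rewrite -[leRHS]lnK ?posrE// ler_expR.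
have H2' : 1 + e / 3 <= (1 + e) * (1 - expR (- y)).
  have : (1 + e) * expR (- y) <= e / 3.
    apply: (le_trans (ler_wpM2l (ltW e1) H2)).
    by rewrite le_eqVlt; apply/orP; left; apply/eqP; field; rewrite !gt_eqF//; lra.
  lra.
rewrite -(ler_pM2l e3).
apply: (le_trans (ler_wpM2r (tail_ge0 y) H2')); rewrite -mulrA.
rewrite [leRHS]mulrCA ler_pM2l//; apply: (le_trans H).
by rewrite ler_wpM2r// tail_ge0.
Qed.

Lemma tail_ratio_exp (y h : R) : 1 <= y -> 0 <= h ->
  tail y <= expR ((y + 1) * h + h ^+ 2 / 2 + 1) * tail (y + h).
Proof.
move=> y1 h0; have y0 : 0 <= y by lra.
have H := tail_ratio y h y0 h0.
have ey : expR (- y) <= 1 / 2.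
  rewrite expRN div1r lef_pV2 ?posrE ?expR_gt0//.
  by have := expR_ge1Dx y; lra.
have e2 : 2 <= expR 1 :> R by have := expR_ge1Dx (1 : R); lra.
have H' : tail y / 2 <= expR ((y + 1) * h + h ^+ 2 / 2) * tail (y + h).
  apply: le_trans H; rewrite mulrC ler_wpM2r ?tail_ge0//; lra.
rewrite expRD -mulrA mulrCA.
apply: (@le_trans _ _ (2 * (expR ((y + 1) * h + h ^+ 2 / 2) * tail (y + h)))); first lra.
by rewrite ler_wpM2r// mulr_ge0 ?expR_ge0 ?tail_ge0.
Qed.

Variables (l s0 s1 : R) (s : R -> R).
Hypothesis l0 : 0 < l.
Hypothesis s00 : 0 < s0.
Hypothesis s_near : \forall u \near +oo, s0 <= s u <= s1.

(** In this section [l] stands for lambda_i and [s u] for beta_i gamma_u, so these quotients are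
    values of [threshold]. *)
Lemma threshold_near (M c : R) : 0 < c ->
  \forall u \near +oo, M <= ln (u * c / l) / s u.
Proof.
move=> c0.
have [M0|M0] := lerP M 0.
  apply: filterS3 s_near (gt_near 0) (ln_near (ln l - ln c)) => u /andP[su _] u0 Lu.
  apply: (le_trans M0); rewrite divr_ge0//; last exact: ltW (lt_le_trans s00 su).
  by rewrite ln_div ?posrE ?mulr_gt0// lnM ?posrE//; lra.
apply: filterS3 s_near (gt_near 0) (ln_near (M * s1 + ln l - ln c)) => u /andP[su us] u0 Lu.
have su0 : 0 < s u := lt_le_trans s00 su.
rewrite ler_pdivlMr// ln_div ?posrE ?mulr_gt0// lnM ?posrE//.
have : M * s u <= M * s1 by rewrite ler_wpM2l// ltW.
lra.
Qed.

Lemma tail_shrink_near (e : R) : 0 < e -> exists2 delta : R, 0 < delta <= 1 &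
  \forall u \near +oo,
    tail (ln (u * expR (- (delta / ln u)) / l) / s u) <= (1 + e) * tail (ln (u / l) / s u).
Proof.
move=> e0.
have le0 : 0 < ln (1 + e / 3) by rewrite ln_gt0//; lra.
(* Collects the bounds y h <= 2 delta / s0 ^ 2, h ^ 2 / 2 <= delta / s0 ^ 2 (this one uses delta <=
   1) and h <= delta / s0. *)
pose K := 3 / s0 ^+ 2 + 1 / s0.
have K0 : 0 < K by rewrite addr_gt0 ?divr_gt0// exprn_gt0.
pose delta := Num.min 1 (ln (1 + e / 3) / K).
have d0 : 0 < delta by rewrite lt_min ltr01 divr_gt0.
have d1 : delta <= 1 by rewrite ge_min lexx.
have dK : delta * K <= ln (1 + e / 3).
  by rewrite -ler_pdivlMr// ge_min lexx orbT.
exists delta; first by rewrite d0.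
have c0 : 0 < expR (- 1) :> R by exact: expR_gt0.
pose M := - ln (e / (3 * (1 + e))).
apply: filterS3 (filterI s_near (threshold_near (Num.max 0 M) _ c0)) (gt_near 0)
  (ln_near (1 + `|ln l|)) => u [/andP[su us] yM] u0 Lu.
set L := ln u in Lu *.
have su0 : 0 < s u := lt_le_trans s00 su.
have nl := normr_ge0 (ln l); have nl1 := ler_norm (ln l).
have nl2 := ler_norm (- ln l); rewrite normrN in nl2.
have L1 : 1 <= L by lra.
have L0 : 0 < L by lra.
have dL : delta / L <= 1 by rewrite ler_pdivrMr//; lra.
have dL0 : 0 < delta / L by rewrite divr_gt0.
have E (x : R) : ln (u * expR x / l) = L + x - ln l.
  by rewrite ln_div ?posrE ?mulr_gt0 ?expR_gt0// lnM ?posrE ?expR_gt0// expRK.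
rewrite E in yM; rewrite E.
set y := (L + - (delta / L) - ln l) / s u.
have yM' : Num.max 0 M <= y.
  by apply: (le_trans yM); rewrite /y ler_pM2r ?invr_gt0//; lra.
move: yM'; rewrite ge_max => /andP[y0 My].
pose h := (delta / L) / s u.
have h0 : 0 <= h by rewrite ltW// divr_gt0.
have -> : ln (u / l) / s u = y + h.
  by rewrite ln_div ?posrE// -/L /y /h -mulrDl; congr (_ / _); ring.
apply: tail_ratio_le => //; last first.
  by rewrite -[leRHS]lnK ?posrE ?divr_gt0 ?mulr_gt0//; [rewrite ler_expR /M in My *; lra|lra].
apply: le_trans dK.
have hs : h <= (delta / L) / s0 by rewrite /h ler_pM2l// lef_pV2 ?posrE.
have hd : h <= delta / s0.
  apply: (le_trans hs); rewrite ler_pM2r ?invr_gt0// ler_pdivrMr// ler_peMr//; lra.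
have yL : y <= 2 * L / s0.
  apply: (@le_trans _ _ (2 * L / s u)); last by rewrite ler_pM2l ?lef_pV2 ?posrE//; lra.
  by rewrite /y ler_pM2r ?invr_gt0//; lra.
have yh : y * h <= 2 * delta / s0 ^+ 2.
  apply: (@le_trans _ _ ((2 * L / s0) * ((delta / L) / s0))); first by rewrite ler_pM.
  rewrite le_eqVlt; apply/orP; left; apply/eqP; field.
  by rewrite !gt_eqF.
have hh : h ^+ 2 / 2 <= delta / s0 ^+ 2.
  apply: (@le_trans _ _ (h ^+ 2)); first by have := sqr_ge0 h; lra.
  apply: (@le_trans _ _ ((delta / s0) ^+ 2)).
    by rewrite lerXn2r ?nnegrE// ltW// divr_gt0.
  by rewrite expr_div_n ler_pM2r ?invr_gt0 ?exprn_gt0// expr2 ler_piMr// ltW.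
have -> : delta * K = 2 * delta / s0 ^+ 2 + delta / s0 ^+ 2 + delta / s0 by rewrite /K; ring.
rewrite mulrDl mul1r; lra.
Qed.

(** Dividing the level by a constant moves the threshold by a bounded amount [h], while [y] is O(ln
    u); hence the loss is only a power of u. *)
Lemma tail_div_near (D : R) : 1 <= D -> exists2 K : R, 0 < K &
  \forall u \near +oo,
    tail (ln (u / D / l) / s u) <= expR (K * ln u) * tail (ln (u / l) / s u).
Proof.
move=> D1; have D0 : 0 < D by lra.
pose a := ln D / s0; have lD : 0 <= ln D by exact: ln_ge0.
have a0 : 0 <= a by rewrite divr_ge0// ltW.
pose K := 2 / s0 * a + a + a ^+ 2 / 2 + 1.
have K0 : 0 < K.
  by rewrite ltr_wpDl// !addr_ge0// ?mulr_ge0 ?invr_ge0 ?sqr_ge0// ltW.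
exists K => //.
have D0' : 0 < D^-1 by rewrite invr_gt0.
apply: filterS3 (filterI s_near (threshold_near 1 _ D0')) (gt_near 0)
  (ln_near (1 + `|ln l|)) => u [/andP[su us] y1] u0 Lu.
set L := ln u in Lu *.
have su0 : 0 < s u := lt_le_trans s00 su.
have nl := normr_ge0 (ln l).
have nl2 := ler_norm (- ln l); rewrite normrN in nl2.
have L1 : 1 <= L by lra.
set y := ln (u / D / l) / s u in y1 *.
have Ey : y = (L - ln D - ln l) / s u.
  by rewrite /y ln_div ?posrE ?mulr_gt0// ln_div ?posrE.
pose h := ln D / s u.
have h0 : 0 <= h by rewrite divr_ge0// ltW.
have -> : ln (u / l) / s u = y + h.
  by rewrite ln_div ?posrE// -/L Ey /h -mulrDl; congr (_ / _); ring.
apply: (le_trans (tail_ratio_exp y h y1 h0)).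
rewrite ler_wpM2r ?tail_ge0// ler_expR.
have ha : h <= a by rewrite /h /a ler_wpM2l// lef_pV2 ?posrE.
have yL : y <= 2 / s0 * L.
  rewrite mulrAC; apply: (@le_trans _ _ (2 * L / s u)); last first.
    by rewrite ler_wpM2l ?lef_pV2 ?posrE//; lra.
  by rewrite Ey ler_pM2r ?invr_gt0//; lra.
have yh : y * h <= 2 / s0 * L * a by rewrite ler_pM//; lra.
have hh : h ^+ 2 <= a ^+ 2 by rewrite lerXn2r ?nnegrE.
have aL : a <= a * L by rewrite ler_peMr.
have aaL : a ^+ 2 / 2 <= a ^+ 2 / 2 * L by rewrite ler_peMr// mulr_ge0 ?sqr_ge0 ?invr_ge0.
have -> : K * L = 2 / s0 * L * a + a * L + a ^+ 2 / 2 * L + L by rewrite /K; ring.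
rewrite mulrDl mul1r; lra.
Qed.

(** Doubling the level moves the threshold by at least a fixed positive amount, and the factor exp(-
    y h) vanishes since [y] tends to infinity. *)
Lemma tail_double_near (e : R) : 0 < e ->
  \forall u \near +oo, tail (ln (u * 2 / l) / s u) <= e * tail (ln (u / l) / s u).
Proof.
move=> e0; have l2 : 0 < ln 2 :> R by rewrite ln_gt0//; lra.
have s10 : 0 < Num.max s1 1 by rewrite lt_max ltr01 orbT.
have c1 : 0 < 1 :> R by [].
apply: filterS3 (filterI s_near (threshold_near (Num.max 0 (- ln e * Num.max s1 1 / ln 2)) 1 c1))
  (gt_near 0) (ln_near 0) => u [/andP[su us] yM] u0 _.
have su0 : 0 < s u := lt_le_trans s00 su.
rewrite mulr1 in yM; move: yM; set y := ln (u / l) / s u => yM.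
move: yM; rewrite ge_max => /andP[y0 yM].
have -> : ln (u * 2 / l) / s u = y + ln 2 / s u.
  rewrite ln_div ?posrE ?mulr_gt0// lnM ?posrE// /y ln_div ?posrE// -mulrDl.
  by congr (_ / _); ring.
have h0 : 0 <= ln 2 / s u by rewrite divr_ge0// ltW.
apply: (le_trans (tailD_le_exp y _ h0)); rewrite ler_wpM2r ?tail_ge0//.
rewrite -[leRHS]lnK ?posrE// ler_expR lerNl.
have us' : s u <= Num.max s1 1 by rewrite le_max us.
have hm : ln 2 / Num.max s1 1 <= ln 2 / s u by rewrite ler_pM2l// lef_pV2 ?posrE.
apply: le_trans (ler_wpM2l y0 hm).
rewrite -ler_pdivrMr ?divr_gt0//; apply: le_trans yM.
by rewrite invf_div mulrA.
Qed.

(* A strictly smaller scale makes the tail superpolynomially smaller: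
   the exponents L^2/(2 s^2), L = ln u, differ at order L^2. *)
Lemma tail_scale_near (b b' K c l' e : R) (gam : R -> R) (G : R) :
  0 < b -> b < b' -> 0 < K -> 0 < c -> 0 < l' -> 0 < e ->
  s = (fun u => b' * gam u) -> 0 < G ->
  (\forall u \near +oo, 0 < gam u <= G) ->
  \forall u \near +oo, expR (K * ln u) * tail (ln (u * c / l') / (b * gam u))
    <= e * tail (ln (u / l) / s u).
Proof.
move=> b0 bb' K0 c0 l'0 e0 sE G0 gnear.
have b'0 : 0 < b' by lra.
(* The two thresholds differ by (2 k L - C) / gamma; one half of the linear term absorbs the
   constant [C]. *)
pose k := (b^-1 - b'^-1) / 2.
have k0 : 0 < k by rewrite divr_gt0// subr_gt0 ltf_pV2 ?posrE.
pose C := (ln l' - ln c) / b - ln l / b'.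
have c1 : 0 < 1 :> R by [].
apply: filterS3 (filterI s_near (threshold_near ((K + 1) * G / k) 1 c1))
  (filterI gnear (gt_near 0)) (filterI (ln_near (Num.max 0 (C / k))) (ln_near (- ln e)))
  => u [/andP[su us] yM] [/andP[g0 gG] u0] [LC Le].
have su0 : 0 < s u := lt_le_trans s00 su.
move: LC; rewrite ge_max => /andP[L0 LC].
rewrite mulr1 in yM; move: yM; set t := ln (u / l) / s u; set L := ln u in Le L0 LC * => yM.
have Et : t = (L - ln l) / (b' * gam u) by rewrite /t ln_div ?posrE// sE.
set y := ln (u * c / l') / (b * gam u).
have Ey : y = (L + ln c - ln l') / (b * gam u).
  by rewrite /y ln_div ?posrE ?mulr_gt0// lnM ?posrE.
pose h := k * L / gam u.
have kL0 : 0 <= k * L by rewrite mulr_ge0// ltW.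
have h0 : 0 <= h by rewrite divr_ge0// ltW.
have th : t + h <= y.
  have -> : y = t + (2 * k * L - C) / gam u.
    by rewrite Ey Et /k /C; field; rewrite !gt_eqF.
  rewrite lerD2l /h ler_pM2r ?invr_gt0//.
  by move: LC; rewrite ler_pdivrMr// (mulrC L); lra.
have KGk0 : 0 <= (K + 1) * G / k.
  by apply: divr_ge0; [apply: mulr_ge0; [lra|exact: ltW]|exact: ltW].
have t0 : 0 <= t := le_trans KGk0 yM.
(* The part K L cancels the prefactor, and the remaining L makes the product smaller than [e]. *)
have thK : (K + 1) * L <= t * h.
  apply: (@le_trans _ _ ((K + 1) * G / k * (k * L / G))).
    by rewrite le_eqVlt; apply/orP; left; apply/eqP; field; rewrite !gt_eqF.
  have hG : k * L / G <= h.
    by rewrite /h ler_wpM2l// lef_pV2 ?posrE.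
  apply: ler_pM => //.
  by rewrite divr_ge0// ltW.
apply: (@le_trans _ _ (expR (K * L) * (expR (- (t * h)) * tail t))).
  rewrite ler_wpM2l ?expR_ge0//; apply: le_trans (tailD_le_exp t h h0).
  exact: tail_le.
rewrite mulrA -expRD ler_wpM2r ?tail_ge0// -[leRHS]lnK ?posrE// ler_expR.
by move: thK Le; rewrite mulrDl mul1r; lra.
Qed.

End TailAsymptotics.

(** * The correlation condition along paths *)

Section CorrelationFactor.
Context {R : realType} {d : nat}.
Variables (B S : 'M[R]_d) (j : 'I_d).
Hypothesis BS : B *m B^T = S.
Hypothesis Bj : forall k, B j k = (k == j)%:R.
Hypothesis S1 : forall i, S i i = 1.

(** Row [j] of [B] is a unit vector, so the scalar product of rows [i] and [j] reads off one
    entry. *)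
Lemma factor_col i : B i j = S i j.
Proof.
rewrite -BS mxE; under eq_bigr do rewrite mxE Bj mulrC.
by rewrite (sum_delta j (B i)).
Qed.

Lemma factor_row_norm i : \sum_k B i k ^+ 2 = 1.
Proof. by rewrite -(S1 i) -BS mxE; apply: eq_bigr => k _; rewrite mxE expr2. Qed.

Lemma factor_row_offdiag i k : k != j -> B i k ^+ 2 <= 1 - S i j ^+ 2.
Proof.
move=> kj; rewrite lerBrDr -(factor_row_norm i) (bigD1 k)//= lerD2l -factor_col.
rewrite (bigD1 j)//=; last by rewrite eq_sym.
by rewrite lerDl sumr_ge0// => m _; exact: sqr_ge0.
Qed.

Lemma corr_sqr_le1 i : S i j ^+ 2 <= 1.
Proof.
rewrite -(factor_row_norm i) -factor_col (bigD1 j)//= lerDl sumr_ge0// => m _.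
exact: sqr_ge0.
Qed.

(** Row [i] has norm 1 and entry sigma_ij in column [j], so each other entry is at most sqrt(1 -
    sigma_ij ^ 2) in absolute value. This produces the square root of the correlation condition. *)
Lemma matvec_replace_at_le i n (t a : R) : 0 <= a -> (forall k, `|n k| <= a) ->
  matvec B (replace_at n j t) i
  <= S i j * t + d%:R * (Num.sqrt (1 - S i j ^+ 2) * a).
Proof.
move=> a0 na; rewrite /matvec (bigD1 j)//= factor_col /replace_at eqxx lerD2l.
rewrite -[X in X%:R]card_ord -sum1_card natr_sum mulr_suml [leRHS](bigD1 j)//=.
have r0 : 0 <= Num.sqrt (1 - S i j ^+ 2) * a by rewrite mulr_ge0 ?sqrtr_ge0.
rewrite mul1r; apply: ler_wpDl => //; apply: ler_sum => k kj.
rewrite (negbTE kj); apply: (le_trans (ler_norm _)); rewrite normrM ler_pM//.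
by rewrite -sqrtr_sqr ler_wsqrtr// factor_row_offdiag.
Qed.

End CorrelationFactor.

Section PathBound.
Context {R : realType} {d : nat}.
Variables (Sigma : R -> 'M[R]_d) (lam beta : 'I_d -> R) (gam : R -> R) (g : R).
Variable (A : 'I_d -> R -> 'M[R]_d).
Hypothesis Sigma1 : forall u, 0 < u -> forall i, Sigma u i i = 1.
Hypothesis lam0 : forall i, 0 < lam i.
Hypothesis beta0 : forall i, 0 < beta i.
Hypothesis gam0 : forall u, 0 < gam u.
Hypothesis g0 : 0 < g.
Hypothesis gamg : gam u @[u --> +oo] --> g.
Hypothesis AS : forall j u, 0 < u -> A j u *m (A j u)^T = Sigma u.
Hypothesis Aj : forall j u, 0 < u -> forall k, A j u j k = (k == j)%:R.
Hypothesis corr : forall c eps : R, 0 < c -> 0 < eps -> exists u0 : R, 0 < u0 /\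
  forall u, u0 < u -> (forall i, lam i < u) ->
  forall j : 'I_d, (forall i, beta i <= beta j) ->
  forall i : 'I_d, i != j ->
    Sigma u i j + c * Num.sqrt ((1 - Sigma u i j ^+ 2) / ln u)
    <= beta j / beta i * (ln (eps * estar lam beta gam i u) / ln u).

Lemma gam_near : \forall u \near +oo, g / 2 <= gam u <= 2 * g.
Proof.
have g0' := g0.
have H1 : \forall u \near +oo, g / 2 <= gam u by apply: (cvgr_ge g gamg); lra.
have H2 : \forall u \near +oo, gam u <= 2 * g by apply: (cvgr_le g gamg); lra.
by apply: filterS2 H1 H2 => u -> ->.
Qed.

Lemma ln_le_quarter (L : R) : 32 <= L -> ln L <= L / 4.
Proof.
move=> L32; rewrite -[leRHS]expRK ler_ln ?posrE ?expR_gt0//; last lra.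
have L4 : 0 <= L / 4 by lra.
apply: le_trans (expR_ge1Dxn 1 L4); rewrite expr_div_n.
have : 32 * L <= L ^+ 2 by rewrite expr2 ler_wpM2r//; lra.
have -> : (2`!%:R : R) = 2 by [].
lra.
Qed.

Lemma Xvec_le_expR (b : R) i y : y i <= b ->
  forall u, Xvec lam beta (gam u) y i <= lam i * expR (beta i * gam u * b).
Proof.
by move=> yb u; rewrite /Xvec ler_pM2l// ler_expR ler_pM2l// mulr_gt0.
Qed.

(* Given N_k for k <> j of size O(sqrt (ln u)) and X_j <= 2 u, the correlation condition
   makes every other coordinate o(u / ln u). *)
Lemma path_bound_near (i j : 'I_d) (eta C : R) : (forall k, beta k <= beta j) -> i != j ->
  0 < eta -> 0 < C ->
  \forall u \near +oo, forall n (t : R), (forall k, `|n k| <= C * Num.sqrt (ln u)) ->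
    0 <= t -> lam j * expR (beta j * gam u * t) <= u * 2 ->
    Xvec lam beta (gam u) (matvec (A j u) (replace_at n j t)) i <= eta * u / ln u.
Proof.
move=> jmax ij eta0 C0.
have [bi bj] := (beta0 i, beta0 j); have g0' := g0.
pose D := d%:R * C.
have D0 : 0 <= D by rewrite mulr_ge0 ?ler0n// ltW.
(* Dominates [beta j * gam u * D] once [gam u <= 2 * g]; the summand 1 makes it positive. *)
pose c := 2 * g * beta j * D + 1.
have c0 : 0 < c by rewrite ltr_wpDl// !mulr_ge0// ltW.
pose q := ln 2 + `|ln (lam j)|.
have ln20 : 0 <= ln 2 :> R by rewrite ln_ge0//; lra.
have q0 : 0 <= q by rewrite addr_ge0.
(* All constants of the final estimate, including e_i^*(u) <= 8 beta_i ^ 2 g ^ 2 u / ln u, so that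
   epsilon = eta / F gives exactly eta u / ln u. *)
pose F := lam i * expR (beta i / beta j * q) * (8 * beta i ^+ 2 * g ^+ 2).
have F0 : 0 < F by rewrite !mulr_gt0 ?expR_gt0// exprn_gt0.
have eps0 : 0 < eta / F by rewrite divr_gt0.
have [u1 [u10 Hcorr]] := corr c (eta / F) c0 eps0.
pose K := 2 * g * beta i * D.
have K0 : 0 <= K by rewrite /K !mulr_ge0// ltW.
have lam_near : \forall u \near +oo, forall k, lam k < u.
  by apply: filter_forall => k; exact: gt_near.
apply: filterS3 (filterI gam_near lam_near) (filterI (gt_near 0) (gt_near u1))
  (filterI (ln_near (32 + 16 * K ^+ 2))
   (filterI (ln_near (4 * `|ln (lam i)|)) (ln_near (2 * (ln (lam i) - ln eta)))))
  => u [/andP[gl gu] lamu] [u0 u1u] [L1 [L2 L3]] n t na t0 xj.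
have gu0 := gam0 u.
set L := ln u in L1 L2 L3 na *.
have L32 : 32 <= L by have := sqr_ge0 K; lra.
have L0 : 0 < L by lra.
set s := Sigma u i j.
have s1 : s ^+ 2 <= 1 by exact: (corr_sqr_le1 _ _ _ (AS j u u0) (Aj j u u0) (Sigma1 u u0)).
have sl : s <= 1.
  by have : `|s| ^+ 2 <= 1 by [rewrite real_normK ?num_real|];
    rewrite expr_le1// => h; apply: le_trans (ler_norm s) h.
have Y := matvec_replace_at_le _ _ _ (AS j u u0) (Aj j u u0) (Sigma1 u u0) i n t _
  (mulr_ge0 (ltW C0) (sqrtr_ge0 L)) na.
rewrite -/s in Y; set r := Num.sqrt (1 - s ^+ 2) in Y.
have r0 : 0 <= r by exact: sqrtr_ge0.
have Y' : matvec (A j u) (replace_at n j t) i <= s * t + D * r * Num.sqrt L.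
  by apply: (le_trans Y); rewrite /D le_eqVlt; apply/orP; left; apply/eqP; ring.
have sL0 : 0 <= Num.sqrt L by exact: sqrtr_ge0.
have sLL : Num.sqrt L ^+ 2 = L by rewrite sqr_sqrtr// ltW.
(* For negative correlation the term [s * t] only helps, and X_i is at most lambda_i exp(K sqrt(ln
   u)). For nonnegative [s] the upper bound on [t] can be multiplied by [s]. *)
have [s_neg|s_pos] := ltP s 0.
  have r1 : r <= 1.
    by rewrite -[leRHS]sqrtr1 ler_wsqrtr// lerBlDr lerDl sqr_ge0.
  have Y2 : matvec (A j u) (replace_at n j t) i <= D * Num.sqrt L.
    apply: (le_trans Y'); apply: (@le_trans _ _ (D * r * Num.sqrt L)).
      by rewrite gerDr mulr_le0_ge0// ltW.
    by rewrite ler_wpM2r// ler_piMr.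
  apply: (le_trans (Xvec_le_expR _ _ _ Y2 u)).
  have e0 : 0 < eta * u / L by rewrite divr_gt0// mulr_gt0.
  rewrite -ler_ln ?posrE//; last by rewrite mulr_gt0 ?expR_gt0.
  rewrite lnM ?posrE ?expR_gt0// expRK ln_div ?posrE ?mulr_gt0// lnM ?posrE//.
  rewrite -/L; have := ln_le_quarter L L32.
  have : beta i * gam u * (D * Num.sqrt L) <= K * Num.sqrt L.
    rewrite /K mulrA ler_wpM2r//.
    have -> : 2 * g * beta i * D = beta i * (2 * g) * D by ring.
    by rewrite ler_wpM2r// ler_pM2l.
  have : K * Num.sqrt L <= L / 4.
    have h : 4 * K <= Num.sqrt L.
      have -> : 4 * K = Num.sqrt ((4 * K) ^+ 2).
        by rewrite sqrtr_sqr ger0_norm// mulr_ge0.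
      by rewrite ler_wsqrtr// exprMn; lra.
    have : (4 * K) * Num.sqrt L <= Num.sqrt L * Num.sqrt L by rewrite ler_wpM2r.
    by rewrite -expr2 sLL; lra.
  lra.
apply: (le_trans (Xvec_le_expR _ _ _ Y' u)).
have bt : beta j * gam u * t <= L + q.
  have ux0 : 0 < lam j * expR (beta j * gam u * t) by rewrite mulr_gt0 ?expR_gt0.
  have u20 : 0 < u * 2 by rewrite mulr_gt0.
  move: xj; rewrite -ler_ln ?posrE// lnM ?posrE ?expR_gt0// expRK.
  rewrite lnM ?posrE// -/L /q.
  by have := ler_norm (- ln (lam j)); rewrite normrN; lra.
set e := estar lam beta gam i u.
have lni : L / 2 <= ln (u / lam i).
  rewrite ln_div ?posrE// -/L; have := ler_norm (ln (lam i)).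
  by have := normr_ge0 (ln (lam i)); lra.
have e0 : 0 < e.
  by rewrite /e /estar divr_gt0//; [rewrite mulr_gt0// exprn_gt0// mulr_gt0|lra].
have eL : e <= (8 * beta i ^+ 2 * g ^+ 2) * (u / L).
  rewrite /e /estar exprMn.
  have g2 : gam u ^+ 2 <= 4 * g ^+ 2.
    have -> : 4 * g ^+ 2 = (2 * g) ^+ 2 by ring.
    by rewrite lerXn2r ?nnegrE//; lra.
  apply: (@le_trans _ _ (beta i ^+ 2 * (4 * g ^+ 2) * u / (L / 2))); last first.
    by rewrite le_eqVlt; apply/orP; left; apply/eqP; field; rewrite gt_eqF.
  apply: ler_pM.
  - by rewrite !mulr_ge0 ?sqr_ge0// ltW.
  - by rewrite invr_ge0; lra.
  - by rewrite ler_pM2r// ler_pM2l// exprn_gt0.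
  - by rewrite lef_pV2 ?posrE//; lra.
have HC := Hcorr u u1u lamu j jmax i ij.
rewrite -/L -/s -/e sqrtrM ?subr_ge0// sqrtrV ?(ltW L0)// -/r in HC.
have sL : 0 < Num.sqrt L by rewrite sqrtr_gt0.
(* The condition multiplied by [beta i / beta j * L], which turns L / sqrt L into sqrt L. *)
have HC2 : beta i / beta j * (s * L + c * r * Num.sqrt L) <= ln (eta / F * e).
  have := ler_wpM2l (_ : 0 <= beta i / beta j * L) HC.
  move=> /(_ (mulr_ge0 (divr_ge0 (ltW bi) (ltW bj)) (ltW L0))).
  have -> : beta i / beta j * L * (s + c * (r / Num.sqrt L))
     = beta i / beta j * (s * L + c * r * (L / Num.sqrt L)) by ring.
  have -> : L / Num.sqrt L = Num.sqrt L by rewrite -{1}sLL expr2 mulfK// gt_eqF.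
  have -> // : beta i / beta j * L * (beta j / beta i * (ln (eta / F * e) / L))
     = ln (eta / F * e) by field; rewrite !gt_eqF.
(* X_j <= 2 u gives [beta j * gam u * t <= L + q], so the exponent of X_i is at most the left side
   of [HC2] plus a constant. *)
have HX : beta i * gam u * (s * t + D * r * Num.sqrt L)
    <= ln (eta / F * e) + beta i / beta j * q.
  apply: le_trans (lerD HC2 (lexx _)); rewrite -mulrDr.
  have -> : beta i * gam u * (s * t + D * r * Num.sqrt L) = beta i / beta j *
     (s * (beta j * gam u * t) + (beta j * gam u * D) * (r * Num.sqrt L)).
    by field; rewrite gt_eqF.
  rewrite ler_pM2l ?divr_gt0//.
  have h1 : s * (beta j * gam u * t) <= s * L + q.
    apply: (le_trans (ler_wpM2l s_pos bt)); rewrite mulrDr lerD2l.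
    by rewrite ler_piMl.
  have h2 : beta j * gam u * D * (r * Num.sqrt L) <= c * (r * Num.sqrt L).
    rewrite ler_wpM2r ?mulr_ge0//.
    apply: (@le_trans _ _ (2 * g * beta j * D)); last by rewrite /c lerDl.
    by rewrite ler_wpM2r// mulrC ler_wpM2r// ltW.
  by rewrite -[c * r * _]mulrA; lra.
apply: (@le_trans _ _ (lam i * expR (ln (eta / F * e) + beta i / beta j * q))).
  by rewrite ler_pM2l// ler_expR.
have fe0 : 0 < eta / F * e := mulr_gt0 eps0 e0.
rewrite expRD lnK ?posrE//.
apply: (@le_trans _ _ (lam i * ((eta / F * ((8 * beta i ^+ 2 * g ^+ 2) * (u / L)))
   * expR (beta i / beta j * q)))).
  by rewrite ler_pM2l// ler_pM2r ?expR_gt0// ler_pM2l.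
rewrite le_eqVlt; apply/orP; left; apply/eqP; rewrite /F; field.
by rewrite !gt_eqF ?expR_gt0.
Qed.

End PathBound.

(** * Relative error *)

Section RatioBound.
Context {R : realType} {d : nat}.

Lemma expR_le_half (x : R) : 0 <= x -> x <= 1 -> expR (- x) <= 1 - x / 2.
Proof.
move=> x0 x1; rewrite expRN.
have x2 : 0 < 1 - x / 2 by lra.
rewrite -[leRHS]invrK lef_pV2 ?posrE ?invr_gt0 ?expR_gt0//.
apply: le_trans (expR_ge1Dx x).
rewrite -[leLHS]div1r ler_pdivrMr//.
have -> : (1 + x) * (1 - x / 2) = 1 + x * (1 - x) / 2 by field.
by rewrite lerDl divr_ge0// mulr_ge0// subr_ge0.
Qed.

(** With S the sum of p over [J] and k = (d + 4) e, both factors of the numerator are at most (1 +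
    k) S and the sum of [m1] is at least (1 - k) S. The 4 absorbs (1 + e) ^ 2 + e <= 1 + 4 e; the d
    counts the indices outside [J]. *)
Lemma second_moment_ratio (p m1 m2 : 'I_d -> R) (J : pred 'I_d) (j : 'I_d) (e : R) :
  0 < e -> e <= 1 -> (d%:R + 4) * e <= 1 / 2 -> J j ->
  (forall i, 0 < p i) -> (forall i, 0 <= m1 i) ->
  (forall i, J i -> m2 i <= ((1 + e) ^+ 2 + e) * p i ^+ 2) ->
  (forall i, J i -> (1 - 2 * e) * p i <= m1 i) ->
  (forall i, ~~ J i -> m2 i / p i <= e * p j) ->
  (forall i, ~~ J i -> p i <= e * p j) ->
  0 < \sum_i m1 i /\
  (\sum_i p i) * (\sum_i m2 i / p i) / (\sum_i m1 i) ^+ 2 <= 1 + 24 * ((d%:R + 4) * e).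
Proof.
move=> e0 e1 ke Jj p0 m10 m2J m1J m2N pN.
set k := (d%:R + 4) * e in ke *.
have dR : 0 <= d%:R :> R by exact: ler0n.
have de0 : 0 <= d%:R * e by rewrite mulr_ge0// ltW.
have kE : k = d%:R * e + 4 * e by rewrite /k mulrDl.
pose S := \sum_(i | J i) p i.
have pS : p j <= S.
  by rewrite /S (bigD1 j)//= lerDl sumr_ge0// => i _; exact: ltW.
have S0 : 0 < S := lt_le_trans (p0 j) pS.
have rest (f : 'I_d -> R) : (forall i, ~~ J i -> f i <= e * p j) ->
    \sum_(i | ~~ J i) f i <= d%:R * e * S.
  move=> fN; apply: (@le_trans _ _ (\sum_(i < d) e * S)).
    rewrite big_mkcond; apply: ler_sum => i _; case: ifPn => [/fN h|_].
      by apply: (le_trans h); rewrite ler_pM2l.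
    by rewrite mulr_ge0// ltW.
  by rewrite sumr_const card_ord -[X in X <= _]mulr_natl mulrA.
have sp : \sum_i p i <= (1 + k) * S.
  rewrite (bigID J)/= -/S; have := rest p pN.
  have : d%:R * e * S <= k * S by rewrite ler_pM2r// kE; lra.
  by rewrite mulrDl mul1r; lra.
have sm2 : \sum_i m2 i / p i <= (1 + k) * S.
  rewrite (bigID J)/=; have := rest (fun i => m2 i / p i) m2N.
  have : \sum_(i | J i) m2 i / p i <= ((1 + e) ^+ 2 + e) * S.
    rewrite /S mulr_sumr; apply: ler_sum => i Ji.
    by rewrite ler_pdivrMr// -mulrA -expr2 m2J.
  have : ((1 + e) ^+ 2 + e + d%:R * e) * S <= (1 + k) * S.
    rewrite ler_pM2r// kE.
    have : e ^+ 2 <= e by rewrite expr2 ler_piMr// ltW.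
    have -> : (1 + e) ^+ 2 = 1 + 2 * e + e ^+ 2 by ring.
    lra.
  by rewrite !mulrDl; lra.
have sm1 : (1 - k) * S <= \sum_i m1 i.
  apply: (@le_trans _ _ ((1 - 2 * e) * S)); first by rewrite ler_pM2r// kE; lra.
  rewrite (bigID J)/= /S mulr_sumr ler_wpDr ?sumr_ge0//.
  by apply: ler_sum => i Ji; exact: m1J.
have k1 : 0 < 1 - k by lra.
have k0 : 0 <= k by rewrite kE; lra.
have m1S : 0 < \sum_i m1 i by apply: lt_le_trans sm1; rewrite mulr_gt0.
split=> //; rewrite ler_pdivrMr ?exprn_gt0//.
have num : (\sum_i p i) * (\sum_i m2 i / p i) <= ((1 + k) * S) ^+ 2.
  have [m2p|m2p] := leP 0 (\sum_i m2 i / p i).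
    rewrite expr2; apply: ler_pM => //; apply: sumr_ge0 => i _; exact: ltW.
  apply: (@le_trans _ _ 0); last exact: sqr_ge0.
  rewrite nmulr_lle0//.
  by apply: sumr_ge0 => i _; exact: ltW.
apply: (le_trans num).
have den : ((1 - k) * S) ^+ 2 <= (\sum_i m1 i) ^+ 2.
  have kS0 : 0 <= (1 - k) * S by rewrite ltW// mulr_gt0.
  by rewrite lerXn2r ?nnegrE// ltW.
have c24 : 0 <= 1 + 24 * k by lra.
apply: le_trans (ler_wpM2l c24 den).
rewrite !exprMn (mulrA (1 + 24 * k)) ler_pM2r ?exprn_gt0//.
(* This and (1 + 4 k) ^ 2 <= 1 + 24 k, valid for k <= 1, yield the constant 24. *)
have h1 : 1 + k <= (1 - k) * (1 + 4 * k).
  have -> : (1 - k) * (1 + 4 * k) = 1 + k + 2 * k * (1 - 2 * k) by ring.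
  by rewrite lerDl mulr_ge0//; lra.
apply: (@le_trans _ _ (((1 - k) * (1 + 4 * k)) ^+ 2)).
  by rewrite lerXn2r ?nnegrE//; [lra|rewrite mulr_ge0//; lra].
rewrite exprMn mulrC ler_wpM2r ?sqr_ge0//.
have -> : (1 + 4 * k) ^+ 2 = 1 + 24 * k - 16 * k * (1 - k) by ring.
by rewrite gerBl mulr_ge0//; lra.
Qed.

End RatioBound.

(** * Moment bounds for each index *)

Section Asymptotics.
Context {R : realType} {d : nat}.
Context {dT : measure_display} {T : measurableType dT} (P : probability T R).
Variables (Sigma : R -> 'M[R]_d) (lam beta : 'I_d -> R) (gam : R -> R) (g : R).
Variables (A : 'I_d -> R -> 'M[R]_d) (N : 'I_d -> T -> R) (I : R -> T -> 'I_d).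
Hypothesis Sigma1 : forall u, 0 < u -> forall i, Sigma u i i = 1.
Hypothesis lam0 : forall i, 0 < lam i.
Hypothesis beta0 : forall i, 0 < beta i.
Hypothesis gam0 : forall u, 0 < gam u.
Hypothesis g0 : 0 < g.
Hypothesis gamg : gam u @[u --> +oo] --> g.
Hypothesis AS : forall j u, 0 < u -> A j u *m (A j u)^T = Sigma u.
Hypothesis Aj : forall j u, 0 < u -> forall k, A j u j k = (k == j)%:R.
Hypothesis stdN : forall i, std_normal_rv P (N i).
Hypothesis indepN : forall u, 0 < u -> mutually_indep P N (I u).
Hypothesis corr : forall c eps : R, 0 < c -> 0 < eps -> exists u0 : R, 0 < u0 /\
  forall u, u0 < u -> (forall i, lam i < u) ->
  forall j : 'I_d, (forall i, beta i <= beta j) ->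
  forall i : 'I_d, i != j ->
    Sigma u i j + c * Num.sqrt ((1 - Sigma u i j ^+ 2) / ln u)
    <= beta j / beta i * (ln (eps * estar lam beta gam i u) / ln u).

Local Notation thr i u x := (threshold lam beta gam u i x).
Local Notation p i u := (tail (thr i u u)).
Local Notation m1 i u := (zmoment P lam beta gam A N u 1 i).
Local Notation m2 i u := (zmoment P lam beta gam A N u 2 i).
Local Notation Xrep j u n t := (Xvec lam beta (gam u) (matvec (A j u) (replace_at n j t))).

Lemma scale_near i :
  \forall u \near +oo, beta i * (g / 2) <= beta i * gam u <= beta i * (2 * g).
Proof.
have := gam_near gam g g0 gamg; apply: filterS => u /andP[h1 h2].
by rewrite !ler_pM2l// h1 h2.
Qed.

Lemma scale_gt0 i : 0 < beta i * (g / 2).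
Proof. by rewrite mulr_gt0// divr_gt0. Qed.

Lemma path_bound_all (j : 'I_d) (eta C : R) : (forall k, beta k <= beta j) ->
  0 < eta -> 0 < C -> \forall u \near +oo, forall i, i != j -> forall n (t : R),
    (forall k, `|n k| <= C * Num.sqrt (ln u)) ->
    0 <= t -> lam j * expR (beta j * gam u * t) <= u * 2 ->
    Xrep j u n t i <= eta * u / ln u.
Proof.
move=> jmax eta0 C0; apply: filter_forall => i.
have [->|ij] := eqVneq i j; first exact: filterE.
have := path_bound_near Sigma lam beta gam g A Sigma1 lam0 beta0 gam0 g0 gamg AS Aj corr
  i j eta C jmax ij eta0 C0.
by apply: filterS => u H _.
Qed.

Lemma sqr_half_sqrt (C L : R) : 0 <= L ->
  (C * Num.sqrt L) ^+ 2 / 2 = C ^+ 2 / 2 * L.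
Proof. by move=> L0; rewrite exprMn sqr_sqrtr// mulrAC. Qed.

Lemma time_ge0 j u t : lam j <= lam j * expR (beta j * gam u * t) -> 0 <= t.
Proof.
rewrite ler_pMr// => h.
have : 0 <= beta j * gam u * t by rewrite -(expR0 R) ler_expR in h.
by rewrite pmulr_rge0// mulr_gt0.
Qed.

Lemma second_moment_near (j : 'I_d) (e : R) : (forall k, beta k <= beta j) -> 0 < e ->
  \forall u \near +oo, m2 j u <= ((1 + e) ^+ 2 + e) * p j u ^+ 2.
Proof.
move=> jmax e0.
have dpos : (0 < d)%N := leq_ltn_trans (leq0n j) (ltn_ord j).
have d1 : 1 <= d%:R :> R by rewrite ler1n.
have d0 : 0 < d%:R :> R by rewrite ltr0n.
have [delta /andP[del0 del1] Hs] :=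
  tail_shrink_near _ _ _ _ (lam0 j) (scale_gt0 j) (scale_near j) e e0.
have [K K0 HK] := tail_div_near _ _ _ _ (lam0 j) (scale_gt0 j) (scale_near j) d%:R d1.
(* The exceptional event then costs u^(-(2 K + 1)) up to a constant, against Z_j ^ 2 <= u^(2 K) p_j
   ^ 2; a factor 1 / u remains. *)
pose C := Num.sqrt (2 * (2 * K + 1)).
have C2 : C ^+ 2 / 2 = 2 * K + 1.
  by rewrite sqr_sqrtr; [field|rewrite mulr_ge0//; lra].
have C0 : 0 < C by rewrite sqrtr_gt0 mulr_gt0//; lra.
(* The other coordinates then add up to at most delta u / (2 L), the gap left below [u] by X_j <= u
   exp(- delta / L) <= u (1 - delta / (2 L)). *)
pose eta := delta / (2 * d%:R).
have eta0 : 0 < eta by rewrite divr_gt0// mulr_gt0.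
have HP := path_bound_all j eta C jmax eta0 C0.
apply: filterS3 (filterI Hs HK) (filterI HP (filterI (gt_near 0) (gt_near (d%:R * lam j))))
  (filterI (ln_near 1) (ln_near (- ln (e / (2 * d%:R)))))
  => u [Hsu HKu] [HPu [u0 ul]] [L1 L2].
set L := ln u in Hsu HKu HPu L1 L2 *.
have L0 : 0 < L by exact: lt_le_trans L1.
have dL0 : 0 < delta / L by rewrite divr_gt0.
have dL1 : delta / L <= 1 by rewrite ler_pdivrMr// mul1r (le_trans del1).
pose a := C * Num.sqrt L.
have a0 : 0 <= a by rewrite mulr_ge0 ?sqrtr_ge0// ltW.
have B0 : 0 < u * expR (- (delta / L)) by rewrite mulr_gt0 ?expR_gt0.
have Zq w := Zcond_le_tail lam beta gam A N u u0 lam0 beta0 (gam0 u) (fun j => Aj j u u0) j w.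
have ZB w : (forall k, `|N k w| <= a) ->
    Zcond lam beta gam A N j u w <= tail (thr j u (u * expR (- (delta / L)))).
  move=> Na; apply: Zcond_le => // t [uS xm]; rewrite ltNge; apply/negP => xB.
  set x := lam j * _ in xB.
  have xE : Xrep j u (Nvec N w) t j = x.
    exact: (Xof_replace_at lam beta gam A u (fun j => Aj j u u0)).
  have X0 k : 0 < Xrep j u (Nvec N w) t k by exact: Xvec_gt0.
  have uB : u * expR (- (delta / L)) <= u by rewrite ler_piMr ?ltW// expR_lt1 oppr_lt0.
  have xu : x <= u := le_trans xB uB.
  have ux : u < d%:R * x.
    by rewrite -xE; apply: (lt_le_trans uS); apply: sum_le_max => // k; exact: ltW.
  (* The maximal X_j exceeds u / d, which is beyond lambda_j, the value at t = 0. *)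
  have t0 : 0 <= t.
    apply: (time_ge0 j u); rewrite -/x -(ler_pM2l d0); apply: ltW.
    exact: lt_trans ul ux.
  have xu2 : x <= u * 2 by apply: (le_trans xu); rewrite ler_peMr// ?ltW// ltr1n.
  have small k : k != j -> Xrep j u (Nvec N w) t k <= eta * u / L.
    by move=> kj; apply: HPu.
  move: uS; apply/negP; rewrite -leNgt /Ssum (bigD1 j)//= xE.
  apply: (@le_trans _ _ (u * (1 - delta / L / 2) + d%:R * (eta * u / L))); last first.
    rewrite le_eqVlt; apply/orP; left; apply/eqP; rewrite /eta; field.
    by rewrite !gt_eqF.
  apply: lerD.
    by apply: (le_trans xB); rewrite ler_pM2l// expR_le_half// ltW.
  rewrite -[X in X%:R]card_ord -sum1_card natr_sum mulr_suml [leRHS](bigD1 j)//=.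
  apply: ler_wpDl; first by rewrite mul1r divr_ge0 ?mulr_ge0// ltW.
  by apply: ler_sum => k kj; rewrite mul1r; exact: small.
apply: (le_trans (zmoment2_le P lam beta gam A N I u stdN (indepN u u0) j a _ _ a0
  (tail_ge0 _) Zq ZB)).
rewrite (sqr_half_sqrt _ _ (ltW L0)) C2 [X in _ <= X]mulrDl.
have p0 := tail_ge0 (thr j u u).
apply: lerD.
  rewrite -exprMn lerXn2r ?nnegrE ?tail_ge0//.
  by rewrite mulr_ge0//; lra.
apply: (@le_trans _ _ ((expR (K * L) * p j u) ^+ 2 * (d%:R * (2 * expR (- ((2 * K + 1) * L)))))).
  apply: ler_wpM2r.
    by apply: mulr_ge0; [exact: ltW|apply: mulr_ge0; [by []|exact: expR_ge0]].
  by rewrite lerXn2r ?nnegrE ?tail_ge0// mulr_ge0 ?expR_ge0.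
rewrite exprMn.
have -> : expR (K * L) ^+ 2 * p j u ^+ 2 * (d%:R * (2 * expR (- ((2 * K + 1) * L))))
  = 2 * d%:R * (expR (K * L) ^+ 2 * expR (- ((2 * K + 1) * L))) * p j u ^+ 2 by ring.
rewrite ler_wpM2r ?sqr_ge0// expr2 -!expRD.
have -> : K * L + K * L - (2 * K + 1) * L = - L by ring.
rewrite mulrC -ler_pdivlMr ?mulr_gt0//.
by rewrite -[leRHS]lnK ?posrE ?divr_gt0 ?mulr_gt0// ler_expR lerNl.
Qed.

Lemma first_moment_near (j : 'I_d) (e : R) : (forall k, beta k <= beta j) ->
  0 < e -> e <= 1 -> \forall u \near +oo, (1 - 2 * e) * p j u <= m1 j u.
Proof.
move=> jmax e0 e1.
have dpos : (0 < d)%N := leq_ltn_trans (leq0n j) (ltn_ord j).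
have d0 : 0 < d%:R :> R by rewrite ltr0n.
have H2 := tail_double_near _ _ _ _ (lam0 j) (scale_gt0 j) (scale_near j) e e0.
(* It suffices here that the others stay below [u] and that the exceptional probability, of order
   u^(-1/2), vanishes; so both constants are 1. *)
have HP := path_bound_all j 1 1 jmax ltr01 ltr01.
apply: filterS3 (filterI H2 HP) (filterI (gt_near 0) (gt_near (lam j)))
  (filterI (ln_near 1) (ln_near (2 * - ln (e / (2 * d%:R)))))
  => u [H2u HPu] [u0 ul] [L1 L2].
set L := ln u in HPu L1 L2 *.
have L0 : 0 < L by exact: lt_le_trans L1.
pose a := 1 * Num.sqrt L.
have a0 : 0 <= a by rewrite mulr_ge0 ?sqrtr_ge0.
have p0 := tail_ge0 (thr j u u).
pose b := p j u - tail (thr j u (u * 2)).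
have bp : (1 - e) * p j u <= b.
  by rewrite mulrBl mul1r lerD2l lerN2; exact: H2u.
have b0 : 0 <= b by apply: le_trans bp; rewrite mulr_ge0// subr_ge0.
have bZ w : (forall k, `|N k w| <= a) -> b <= Zcond lam beta gam A N j u w.
  move=> Na; apply: Zcond_ge => //; first exact: (fun j => Aj j u u0).
    by rewrite ler_peMr// ?ltW// ltr1n.
  move=> t k /andP[ux xu] kj.
  have t0 : 0 <= t by apply: (time_ge0 j u); apply: ltW; exact: lt_trans ul ux.
  apply: (le_trans (HPu k kj _ t Na t0 xu)).
  by rewrite mul1r ler_pdivrMr// ler_peMr// ltW.
apply: le_trans (zmoment1_ge P lam beta gam A N I u stdN (indepN u u0) j a b a0 b0 bZ).
rewrite /a (sqr_half_sqrt _ _ (ltW L0)) expr1n.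
have small : d%:R * (2 * expR (- (1 / 2 * L))) <= e.
  have -> : d%:R * (2 * expR (- (1 / 2 * L))) = expR (- (1 / 2 * L)) * (2 * d%:R) by ring.
  rewrite -ler_pdivlMr ?mulr_gt0//.
  rewrite -[leRHS]lnK ?posrE ?divr_gt0 ?mulr_gt0// ler_expR; lra.
apply: (@le_trans _ _ ((1 - e) * p j u * (1 - e))).
  have -> : (1 - e) * p j u * (1 - e) = (1 - 2 * e) * p j u + e ^+ 2 * p j u by ring.
  by rewrite lerDl mulr_ge0 ?sqr_ge0.
apply: ler_pM => //; [by rewrite mulr_ge0// subr_ge0|by rewrite subr_ge0|].
by rewrite lerD2l lerN2.
Qed.

(** With q = P(X_i > u / d), the quotient is at most c q ^ 2 / p_i <= c u^K q, and the smaller scale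
    beta_i makes [q] smaller than p_j by more than any power of u. *)
Lemma light_near (i j : 'I_d) (e : R) : beta i < beta j -> 0 < e ->
  \forall u \near +oo, m2 i u / p i u <= e * p j u /\ p i u <= e * p j u.
Proof.
move=> bij e0.
have dpos : (0 < d)%N := leq_ltn_trans (leq0n j) (ltn_ord j).
have d1 : 1 <= d%:R :> R by rewrite ler1n.
have d0 : 0 < d%:R :> R by rewrite ltr0n.
(* The constant of [zmoment2_le] at cutoff 0, where both bounds on Z_i are [q] and the exponential
   is 1. *)
pose c := 1 + d%:R * 2 : R.
have c0 : 1 <= c by rewrite lerDl mulr_ge0// ltW.
have c0' : 0 < c by lra.
have ec : 0 < e / c by rewrite divr_gt0.
have [K K0 HK] := tail_div_near _ _ _ _ (lam0 i) (scale_gt0 i) (scale_near i) d%:R d1.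
have di0 : 0 < (d%:R : R)^-1 by rewrite invr_gt0.
have G0 : 0 < 2 * g by rewrite mulr_gt0.
have Hg : \forall u \near +oo, 0 < gam u <= 2 * g.
  by have := gam_near gam g g0 gamg; apply: filterS => u /andP[_ ->]; rewrite gam0.
have HS := tail_scale_near _ _ _ _ (lam0 j) (scale_gt0 j) (scale_near j)
  (beta i) (beta j) K d%:R^-1 (lam i) (e / c) gam (2 * g) (beta0 i) bij K0 di0 (lam0 i) ec
  erefl G0 Hg.
apply: filterS3 HK HS (filterI (gt_near 0) (ln_near 0)) => u HKu HSu [u0 L0].
set q := tail (thr i u (u / d%:R)).
have HKq : q <= expR (K * ln u) * p i u := HKu.
have HSq : expR (K * ln u) * q <= e / c * p j u := HSu.
have pi0 := tail_gt0 (thr i u u); have pj0 := tail_gt0 (thr j u u).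
have q0 : 0 <= q := tail_ge0 _.
have pq : p i u <= q.
  apply: tail_le; rewrite /threshold ler_pM2r ?invr_gt0 ?mulr_gt0//.
  rewrite ler_ln ?posrE ?divr_gt0// ler_pM2r ?invr_gt0//.
  by rewrite ler_pdivrMr// ler_peMr// ltW.
have E1 : 1 <= expR (K * ln u) by rewrite -[leLHS]expR0 ler_expR mulr_ge0// ltW.
split; last first.
  apply: (le_trans pq); apply: (@le_trans _ _ (expR (K * ln u) * q)).
    by rewrite ler_peMl.
  by apply: (le_trans HSq); rewrite ler_pM2r// ler_pdivrMr// ler_peMr// ltW.
have Zq w := Zcond_le_tail lam beta gam A N u u0 lam0 beta0 (gam0 u) (fun j => Aj j u u0) i w.
have := zmoment2_le P lam beta gam A N I u stdN (indepN u u0) i 0 q q (lexx 0) q0 Zq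
  (fun w _ => Zq w).
rewrite expr0n/= mul0r oppr0 expR0 mulr1 => H.
have H' : m2 i u <= c * q ^+ 2 by apply: (le_trans H); rewrite /c; lra.
rewrite ler_pdivrMr//; apply: (le_trans H').
apply: (@le_trans _ _ (c * (e / c * p j u * p i u))).
  rewrite ler_pM2l// expr2.
  apply: (@le_trans _ _ (q * (expR (K * ln u) * p i u))); first by rewrite ler_wpM2l.
  by rewrite mulrCA mulrA ler_pM2r.
rewrite le_eqVlt; apply/orP; left; apply/eqP; field.
by rewrite gt_eqF.
Qed.

End Asymptotics.

Theorem theorem1 (R : realType) (d : nat) (hd : (2 <= d)%N)
  (dT : measure_display) (T : measurableType dT) (P : probability T R)
  (Sigma : R -> 'M[R]_d) (lam beta : 'I_d -> R) (gam : R -> R) (g : R)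
  (A : 'I_d -> R -> 'M[R]_d) (N : 'I_d -> T -> R) (I : R -> T -> 'I_d) :
  (* Sigma_u : positive definite correlation matrix *)
  (forall u, 0 < u -> (Sigma u)^T = Sigma u) ->
  (forall u, 0 < u -> forall i, Sigma u i i = 1) ->
  (forall u, 0 < u -> forall v : 'rV[R]_d, v != 0 ->
      0 < (v *m Sigma u *m v^T) ord0 ord0) ->
  (forall i, 0 < lam i) -> (forall i, 0 < beta i) ->
  (forall u, 0 < gam u) -> 0 < g -> gam u @[u --> +oo] --> g ->
  (* A_u^{(j)} : non-singular, A A^T = Sigma_u, j-th row = j-th unit vector *)
  (forall j u, 0 < u -> A j u \in unitmx) ->
  (forall j u, 0 < u -> A j u *m (A j u)^T = Sigma u) ->
  (forall j u, 0 < u -> forall k, A j u j k = (k == j)%:R) ->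
  (* N_1..N_d i.i.d. standard Gaussian; I(u) independent of N, with law p_i/sum p *)
  (forall i, std_normal_rv P (N i)) ->
  (forall u, 0 < u -> forall i, measurable (I u @^-1` [set i])) ->
  (forall u, 0 < u -> mutually_indep P N (I u)) ->
  (forall u, 0 < u -> forall i,
      P (I u @^-1` [set i]) =
      (p_tail P lam beta gam A N i u / \sum_(k < d) p_tail P lam beta gam A N k u)%:E) ->
  (* condition on the correlations *)
  (forall c eps : R, 0 < c -> 0 < eps -> exists u0 : R, 0 < u0 /\
     forall u, u0 < u -> (forall i, lam i < u) ->
     forall j : 'I_d, (forall i, beta i <= beta j) ->
     forall i : 'I_d, i != j ->
       Sigma u i j + c * Num.sqrt ((1 - Sigma u i j ^+ 2) / ln u)
       <= beta j / beta i * (ln (eps * estar lam beta gam i u) / ln u)) ->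
  (* unbiasedness *)
  (forall (j0 : 'I_d) u, 0 < u ->
     (\int[P]_w (Zmak P lam beta gam A N I u w)%:E)%E
     = (alpha P lam beta gam A N j0 u)%:E) /\
  (* vanishing relative error *)
  (forall j0 : 'I_d,
     fine (\int[P]_w ((Zmak P lam beta gam A N I u w) ^+ 2)%:E)%E
       / alpha P lam beta gam A N j0 u ^+ 2 @[u --> +oo] --> (1 : R)).
Proof.
move=> _ S1 _ lam0 beta0 gam0 g0 gamg uA AS Aj stdN mI indepN lawI corr.
have AA u (u0 : 0 < u) i j : A i u *m (A i u)^T = A j u *m (A j u)^T by rewrite !AS.
split=> [j0 u u0|j0].
  exact: (integral_Zmak P lam beta gam A N I u u0 lam0 beta0 (gam0 u) (fun j => uA j u u0)
    (AA u u0) (fun j => Aj j u u0) stdN (indepN u u0) (mI u u0) (lawI u u0) j0).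
pose j := [arg max_(i > j0) beta i]%O.
have jmax k : beta k <= beta j by rewrite /j; case: arg_maxP => // m _; exact.
pose J : pred 'I_d := fun i => beta i == beta j.
have JP i : J i -> forall k, beta k <= beta i by move=> /eqP -> k.
have JN i : ~~ J i -> beta i < beta j by move=> Ji; rewrite lt_neqAle Ji jmax.
apply/cvgrPdist_le => eps eps0.
have d4 : 0 < d%:R + 4 :> R by rewrite ltr_wpDl ?ler0n.
(* Makes (d + 4) e at most 1 / 2, as [second_moment_ratio] requires, and 24 (d + 4) e at most
   [eps]. *)
pose e := Num.min (1 / 2) (eps / 24) / (d%:R + 4).
have m0 : 0 < Num.min (1 / 2) (eps / 24) :> R by rewrite lt_min !divr_gt0.
have e0 : 0 < e by rewrite divr_gt0.
have ke : (d%:R + 4) * e = Num.min (1 / 2) (eps / 24) by rewrite mulrC divfK// gt_eqF.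
have ke2 : (d%:R + 4) * e <= 1 / 2 by rewrite ke ge_min lexx.
have keps : (d%:R + 4) * e <= eps / 24 by rewrite ke ge_min lexx orbT.
have e1 : e <= 1.
  have dR : 0 <= d%:R :> R by exact: ler0n.
  have : 0 <= d%:R * e by rewrite mulr_ge0// ltW.
  by rewrite mulrDl in ke2; lra.
have H2 : \forall u \near +oo, forall i, J i ->
    zmoment P lam beta gam A N u 2 i
      <= ((1 + e) ^+ 2 + e) * tail (threshold lam beta gam u i u) ^+ 2.
  apply: filter_forall => i; have [Ji|nJ] := boolP (J i); last exact: filterE.
  have := second_moment_near P Sigma lam beta gam g A N I S1 lam0 beta0 gam0 g0 gamg AS Aj
    stdN indepN corr i e (JP i Ji) e0.
  by apply: filterS.
have H1 : \forall u \near +oo, forall i, J i ->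
    (1 - 2 * e) * tail (threshold lam beta gam u i u) <= zmoment P lam beta gam A N u 1 i.
  apply: filter_forall => i; have [Ji|nJ] := boolP (J i); last exact: filterE.
  have := first_moment_near P Sigma lam beta gam g A N I S1 lam0 beta0 gam0 g0 gamg AS Aj
    stdN indepN corr i e (JP i Ji) e0 e1.
  by apply: filterS.
have H0 : \forall u \near +oo, forall i, ~~ J i ->
    zmoment P lam beta gam A N u 2 i / tail (threshold lam beta gam u i u)
      <= e * tail (threshold lam beta gam u j u) /\
    tail (threshold lam beta gam u i u) <= e * tail (threshold lam beta gam u j u).
  apply: filter_forall => i; have [Ji|nJ] := boolP (J i); first exact: filterE.
  have := light_near P lam beta gam g A N I lam0 beta0 gam0 g0 gamg Aj
    stdN indepN i j e (JN i nJ) e0.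
  by apply: filterS.
apply: filterS3 (filterI H1 H2) H0 (gt_near 0) => u [H1u H2u] H0u u0.
have pE i := p_tailE P lam beta gam A N u u0 lam0 beta0 (gam0 u) (fun j => Aj j u u0) stdN i.
have EZ2 := integral_Zmak_sqr P lam beta gam A N I u u0 lam0 beta0 (gam0 u)
  (fun j => Aj j u u0) stdN (indepN u u0) (mI u u0) (lawI u u0) j0.
have Ea := sum_zmoment P lam beta gam A N I u lam0 beta0 (gam0 u) (fun j => uA j u u0)
  (AA u u0) stdN (indepN u u0) j0.
have jens := alpha_sqr_le P lam beta gam A N I u u0 lam0 beta0 (gam0 u) (fun j => uA j u u0)
    (AA u u0) (fun j => Aj j u u0) stdN (indepN u u0) (mI u u0) (lawI u u0) j0.
have m1_ge0 i : 0 <= zmoment P lam beta gam A N u 1 i.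
  apply/fine_ge0/integral_ge0 => w _; rewrite lee_fin expr1; exact: Zcond_ge0.
have [a0 ratio] := second_moment_ratio (fun i => tail (threshold lam beta gam u i u))
  (zmoment P lam beta gam A N u 1) (zmoment P lam beta gam A N u 2) J j e e0 e1 ke2
  (eqxx _) (fun i => tail_gt0 _) m1_ge0 H2u H1u
  (fun i nJ => (H0u i nJ).1) (fun i nJ => (H0u i nJ).2).
rewrite Ea in a0 ratio.
have EZ2' : fine (\int[P]_w ((Zmak P lam beta gam A N I u w) ^+ 2)%:E)%E =
    (\sum_i tail (threshold lam beta gam u i u)) *
    (\sum_i zmoment P lam beta gam A N u 2 i / tail (threshold lam beta gam u i u)).
  rewrite EZ2; congr (_ * _); first by apply: eq_bigr => i _; exact: pE.
  by apply: eq_bigr => i _; rewrite pE.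
rewrite -EZ2' in ratio.
(* With the ratio at least 1, its distance to 1 is governed by the upper bound alone. *)
have r1 : 1 <= fine (\int[P]_w ((Zmak P lam beta gam A N I u w) ^+ 2)%:E)%E
    / alpha P lam beta gam A N j0 u ^+ 2.
  by rewrite ler_pdivlMr ?exprn_gt0// mul1r.
rewrite distrC ger0_norm ?subr_ge0// lerBlDl.
by apply: (le_trans ratio); lra.
Qed.
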